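(* Let $n\ge 2$ and $0\le\alpha<n$. Then there is a sequence $\{(\widehat\sigma_N,\widehat\omega_N)\}_{N=1}^\infty$ of pairs of locally finite positive Borel measures on $\mathbb{R}^n$, each of which is a finite sum of point masses, such that the backward deep energy constants $\mathcal{E}_2^{\alpha,\operatorname{deep},\ast}(\widehat\sigma_N,\widehat\omega_N)$ are unbounded in $N\ge1$, and yet the vector fractional Riesz transform $\mathbf{R}^{\alpha,n}$ is bounded from $L^2(\widehat\sigma_N)$ to $L^2(\widehat\omega_N)$ uniformly in $N\ge1$, i.e. there is a constant $C<\infty$ independent of $N$ with $\|\mathbf{R}^{\alpha,n}_{\widehat\sigma_N,\delta,R}f\|_{L^2(\widehat\omega_N)}\le C\|f\|_{L^2(\widehat\sigma_N)}$ for all $N\ge1$, all $f\in L^2(\widehat\sigma_N)$ and all $0<\delta<R<\infty$.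
   Context: The vector fractional Riesz transform $\mathbf{R}^{\alpha,n}$ on $\mathbb{R}^n$ is the convolution operator with vector kernel $\mathbf{K}^{\alpha,n}(x,y)=\frac{x-y}{|x-y|^{n+1-\alpha}}$. Its truncations are $\mathbf{R}^{\alpha,n}_{\sigma,\delta,R}f(x)=\int\eta_{\delta,R}(|x-y|)\mathbf{K}^{\alpha,n}(x,y)f(y)\,d\sigma(y)$, where $\{\eta_{\delta,R}\}_{0<\delta<R<\infty}$ is a fixed family of nonnegative functions on $[0,\infty)$ making the truncated kernels bounded with compact support for fixed $x$ or $y$ (in the presence of the Muckenhoupt conditions the choice of truncation family does not matter); boundedness from $L^2(\sigma)$ to $L^2(\omega)$ means these truncations are bounded uniformly in $0<\delta<R$. Notation: cubes are axis-parallel; $\ell(Q)$ is the side length, $|Q|$ the Lebesgue measure, $c_Q$ the center, $|Q|_\mu=\mu(Q)$. The standard Poisson integral is $\mathrm{P}^\alpha(Q,\mu)=\int_{\mathbb{R}^n}\frac{|Q|^{1/n}}{(|Q|^{1/n}+|x-c_Q|)^{n+1-\alpha}}d\mu(x)$. For a cube $M$ and measure $\mu$, $\mathsf{P}^\mu_M$ denotes the orthogonal projection of $L^2(\mu)$ onto the subspace of functions supported in $M$ with $\int_M f\,d\mu=0$ (the Haar projection $\sum_{J\in\mathcal D,J\subset M}\triangle^\mu_J$), applied componentwise to the identity function $x$. Deep embedding: fix parameters $\mathbf r\in\mathbb{N}$, $0<\varepsilon<1$, $\gamma>1$. A dyadic cube $J$ is $(\mathbf r,\varepsilon)$-deeply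 embedded in a cube $K$, written $J\Subset_{\mathbf r,\varepsilon}K$, if $J\subset K$, $\ell(J)\le 2^{-\mathbf r}\ell(K)$ and $\operatorname{dist}(J,\partial K)\ge\frac12\ell(J)^\varepsilon\ell(K)^{1-\varepsilon}$. For a dyadic grid $\mathcal D$ and cube $K$, $\mathcal M_{\operatorname{deep}}(K)$ is the set of maximal $\mathcal D$-dyadic $J\Subset_{\mathbf r,\varepsilon}K$, and for $\ell\ge1$, $\mathcal M^\ell_{\operatorname{deep}}(K)$ is the set of $J\in\mathcal M_{\operatorname{deep}}(\pi^\ell K')$ for some $\mathcal D$-dyadic child $K'$ of $K$ ($\pi^\ell K'$ its $\ell$-th dyadic ancestor) such that $J\subset L$ for some $L\in\mathcal M_{\operatorname{deep}}(K)$. The backward deep energy constant of a pair $(\sigma,\omega)$ is given by $$\big(\mathcal{E}_2^{\alpha,\operatorname{deep},\ast}\big)^2=\sup_{\ell\ge1}\sup_{\mathcal D}\sup_{I=\dot\cup I_r}\frac{1}{|I|_\omega}\sum_{r}\sum_{M\in\mathcal M^\ell_{\operatorname{deep}}(I_r)}\Big(\frac{\mathrm{P}^\alpha(M,\mathbf 1_{I\setminus\gamma M}\omega)}{\ell(M)}\Big)^2\|\mathsf P^\sigma_M x\|^2_{L^2(\sigma)},$$ the suprema over all dyadic grids $\mathcal D$, all $\mathcal D$-dyadic cubes $I$, and all partitions of $I$ into $\mathcal D$-dyadic subcubes $I_r$ (i.e. the forward deep energy with the roles of $\sigma$ and $\omega$ interchanged). *)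

(* Defs.v *)
From HB Require Import structures.
From mathcomp Require Import all_boot all_order all_algebra.
From mathcomp Require Import all_classical all_reals all_analysis.
Set Implicit Arguments. Unset Strict Implicit. Unset Printing Implicit Defensive.
Import Order.TTheory GRing.Theory Num.Theory.
Import numFieldNormedType.Exports.
Local Open Scope classical_set_scope.
Local Open Scope ring_scope.

Section Defs.
Variables (R : realType) (n : nat).

Definition pt := 'rV[R]_n.

Definition enorm (x : pt) : R := Num.sqrt (\sum_(i < n) (x ord0 i) ^+ 2).

(* A positive measure which is a finite sum of point masses:
   the list of pairs (point, mass); the measure is \sum_k m_k \delta_{p_k}. *)
Definition dmeas := seq (pt * R).
Definition pos_dmeas (mu : dmeas) : Prop := forall pw, pw \in mu -> 0 < pw.2.

Definition dmass (mu : dmeas) (A : set pt) : R :=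
  \sum_(pw <- mu) (if `[< A pw.1 >] then pw.2 else 0).
Definition dint (mu : dmeas) (A : set pt) (f : pt -> R) : R :=
  \sum_(pw <- mu) (if `[< A pw.1 >] then f pw.1 * pw.2 else 0).

Definition cube := (pt * R)%type.
Definition cube_set (Q : cube) : set pt :=
  [set x | forall i : 'I_n, Q.1 ord0 i <= x ord0 i < Q.1 ord0 i + Q.2].
Definition side (Q : cube) : R := Q.2.
Definition center (Q : cube) : pt := Q.1 + (Q.2 / 2) *: const_mx 1.
Definition dilate (c : R) (Q : cube) : cube :=
  (center Q - (c * Q.2 / 2) *: const_mx 1, c * Q.2).

(* dyadic grids: at each level k : int the cubes of side 2^k form the
   lattice 2^k Z^n + t k, and the levels are nested. *)
Definition grid_ok (t : int -> pt) : Prop :=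
  forall (k : int) (i : 'I_n), exists z : int,
    t k ord0 i - t (k + 1)%R ord0 i = (2 : R) ^ k * z%:~R.
Definition in_grid (t : int -> pt) (Q : cube) : Prop :=
  exists (k : int) (m : 'I_n -> int),
    Q.2 = (2 : R) ^ k /\ forall i, Q.1 ord0 i = (2 : R) ^ k * (m i)%:~R + t k ord0 i.

Definition dist_set (A B : set pt) : R :=
  inf [set enorm (x - y) | x in A & y in B].
Definition bdry (A : set pt) : set pt := closure A `\` interior A.

Definition deep_emb (r : nat) (eps : R) (J K : cube) : Prop :=
  cube_set J `<=` cube_set K /\
  side J <= (2 : R) ^- r * side K /\
  dist_set (cube_set J) (bdry (cube_set K)) >=
    2^-1 * (powR (side J) eps) * (powR (side K) (1 - eps)).

Definition Mdeep (t : int -> pt) (r : nat) (eps : R) (K : cube) : set cube :=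
  [set J | in_grid t J /\ deep_emb r eps J K /\
     forall J', in_grid t J' -> deep_emb r eps J' K ->
       cube_set J `<=` cube_set J' -> cube_set J' = cube_set J].

Definition dchild (t : int -> pt) (K' K : cube) : Prop :=
  in_grid t K' /\ side K' = side K / 2 /\ cube_set K' `<=` cube_set K.
Definition dancestor (t : int -> pt) (l : nat) (K' P : cube) : Prop :=
  in_grid t P /\ side P = (2 : R) ^+ l * side K' /\ cube_set K' `<=` cube_set P.

Definition Mdeep_l (t : int -> pt) (r : nat) (eps : R) (l : nat) (K : cube)
  : set cube :=
  [set J | (exists K' P, dchild t K' K /\ dancestor t l K' P /\ Mdeep t r eps P J)
           /\ exists L, Mdeep t r eps K L /\ cube_set J `<=` cube_set L].

Definition poisson (alpha : R) (Q : cube) (mu : dmeas) (A : set pt) : R :=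
  dint mu A (fun x => side Q /
     powR (side Q + enorm (x - center Q)) (n%:R + 1 - alpha)).

(* || P^mu_M x ||^2_{L^2(mu)}, where P^mu_M is the orthogonal projection
   onto the functions supported in M with mu-integral 0, i.e.
   P^mu_M f = 1_M (f - <f>^mu_M)  (and 0 if mu(M) = 0), applied componentwise
   to the identity function x. *)
Definition proj_x_sq (mu : dmeas) (M : cube) : R :=
  let avg := (dmass mu (cube_set M))^-1 *:
             \sum_(pw <- mu) (if `[< cube_set M pw.1 >] then pw.2 *: pw.1 else 0) in
  dint mu (cube_set M) (fun x => enorm (x - avg) ^+ 2).

Definition bw_deep_energy_sq (alpha : R) (r : nat) (eps gam : R)
  (sigma omega : dmeas) : \bar R :=
  ereal_sup [set x | exists (l : nat) (t : int -> pt) (I : cube) (Pt : set cube),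
    (1 <= l)%N /\ grid_ok t /\ in_grid t I /\
    (forall Q, Pt Q -> in_grid t Q /\ cube_set Q `<=` cube_set I) /\
    (forall Q Q', Pt Q -> Pt Q' -> Q <> Q' -> cube_set Q `&` cube_set Q' = set0) /\
    cube_set I = \bigcup_(Q in Pt) cube_set Q /\
        x = (((dmass omega (cube_set I))^-1)%:E *
            \esum_(Ir in Pt) \esum_(M in Mdeep_l t r eps l Ir)
               ((poisson alpha M omega (cube_set I `\` cube_set (dilate gam M))
                   / side M) ^+ 2 * proj_x_sq sigma M)%:E)%E].

Definition eta (delta R0 s : R) : R := if (delta <= s <= R0) then 1 else 0.

Definition riesz_trunc (alpha : R) (sigma : dmeas) (delta R0 : R) (f : pt -> R)
  (x : pt) : pt :=
  \sum_(pw <- sigma)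
     (eta delta R0 (enorm (x - pw.1)) * f pw.1 * pw.2 /
        powR (enorm (x - pw.1)) (n%:R + 1 - alpha)) *: (x - pw.1).

Definition L2norm (mu : dmeas) (f : pt -> R) : R :=
  Num.sqrt (dint mu setT (fun x => f x ^+ 2)).
Definition L2norm_vec (mu : dmeas) (F : pt -> pt) : R :=
  Num.sqrt (dint mu setT (fun x => enorm (F x) ^+ 2)).

End Defs.

(* Main.v *)
Require Import Defs.
From HB Require Import structures.
From mathcomp Require Import all_boot all_order all_algebra.
From mathcomp Require Import all_classical all_reals all_analysis.
From mathcomp Require Import ring lra.
Import Order.TTheory GRing.Theory Num.Theory.
Import numFieldNormedType.Exports.
Local Open Scope classical_set_scope.
Local Open Scope ring_scope.

(** Write s = n - alpha. Four unit masses at (±1, ±b) produce a Riesz field which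
    vanishes at both points (±d, 0) for a suitable b: the field has no first
    component there since u / (u^2 + b^2)^((s+1)/2) takes the same value at 1 + d and
    1 - d, and the second component cancels by symmetry. Iterating this configuration N
    times with a tiny ratio tau gives a measure omega of mass 1 carried by 4^N points,
    and each node of the tree, of scale rho = tau^k and mass u = 4^-k, carries two points of
    sigma, of mass rho^(2s) / u, at the zeros of the field of its four children.

    Because of the exact cancellation, the adjoint operator applied to g sees, at
    the sigma-points of a node, only the martingale difference of g at that node;
    these differences are orthogonal, so the norm stays bounded, up to interactions
    between different scales, which vanish as tau -> 0, and up to the at most two scales
    cut by the truncation. On the other hand no omega-mass lies near the two sigma-points
    of a node, so that the node contributes a constant times u to the energy, and each
    of the N generations a constant. *)

Set Implicit Arguments. Unset Strict Implicit. Unset Printing Implicit Defensive.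

(** * Weighted sums over finite sums of point masses *)

Section WeightedSums.
Context {R : realType} {n : nat}.
Implicit Types (mu : dmeas R n) (F G : pt R n -> R).

Definition wsum mu F : R := \sum_(q <- mu) q.2 * F q.1.

Lemma eq_wsum mu F G : (forall q, q \in mu -> F q.1 = G q.1) ->
  wsum mu F = wsum mu G.
Proof. by move=> FG; apply: eq_big_seq => q /FG ->. Qed.

Lemma wsumD mu F G : wsum mu (fun x => F x + G x) = wsum mu F + wsum mu G.
Proof. by rewrite /wsum -big_split; apply: eq_bigr => q _; rewrite mulrDr. Qed.

Lemma wsumZ mu (c : R) F : wsum mu (fun x => c * F x) = c * wsum mu F.
Proof. by rewrite /wsum mulr_sumr; apply: eq_bigr => q _; ring. Qed.

Lemma wsum_sum (I : finType) mu (F : I -> pt R n -> R) :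
  wsum mu (fun x => \sum_i F i x) = \sum_i wsum mu (F i).
Proof.
rewrite /wsum exchange_big; apply: eq_bigr => q _ /=; by rewrite mulr_sumr.
Qed.

Lemma le_wsum mu F G : pos_dmeas mu ->
  (forall q, q \in mu -> F q.1 <= G q.1) -> wsum mu F <= wsum mu G.
Proof.
move=> mu0 FG; rewrite /wsum !big_seq; apply: ler_sum => q qmu.
by rewrite ler_wpM2l ?FG// ltW// mu0.
Qed.

Lemma wsum_ge0 mu F : pos_dmeas mu ->
  (forall q, q \in mu -> 0 <= F q.1) -> 0 <= wsum mu F.
Proof.
move=> mu0 F0; rewrite /wsum big_seq; apply: sumr_ge0 => q qmu.
by rewrite mulr_ge0 ?F0// ltW// mu0.
Qed.

(** The variance of [F] under the probability measure [mu] is nonnegative. *)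
Lemma wsum_jensen mu F : pos_dmeas mu -> wsum mu (cst 1) = 1 ->
  wsum mu F ^+ 2 <= wsum mu (fun x => F x ^+ 2).
Proof.
move=> mu0 mu1; set m := wsum mu F.
have : 0 <= wsum mu (fun x => (F x - m) ^+ 2).
  by apply: wsum_ge0 => // q _; exact: sqr_ge0.
have -> : (fun x => (F x - m) ^+ 2) =
    (fun x => F x ^+ 2 + ((- 2 * m) * F x + m ^+ 2 * cst 1 x)).
  by apply/funext => x /=; ring.
rewrite !wsumD !wsumZ mu1 -/m; lra.
Qed.

(** The crude bound, for interactions without cancellation: Jensen, then the pointwise bound on the
    kernel. *)
Lemma wsum_norm_le mu F (k : pt R n -> R) (C : R) :
  pos_dmeas mu -> wsum mu (cst 1) = 1 ->
  (forall q, q \in mu -> `|k q.1| <= C) ->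
  wsum mu (fun x => k x * F x) ^+ 2 <= C ^+ 2 * wsum mu (fun x => F x ^+ 2).
Proof.
move=> mu0 mu1 kC; apply: le_trans (wsum_jensen _ mu0 mu1) _.
rewrite -wsumZ; apply: le_wsum => // q qmu.
rewrite exprMn ler_wpM2r ?sqr_ge0// -real_normK ?num_real//.
by rewrite lerXn2r ?nnegrE ?kC// (le_trans _ (kC _ qmu)).
Qed.

(* The bound for the adjoint gives the one for the operator: with h := T f one
   has |h|^2 = <f, T^* h> <= (C |f|^2 + |T^* h|^2 / C) / 2. *)
Lemma adjoint_bound (sigma omega : dmeas R n) (k : pt R n -> pt R n -> R) (C : R) :
  0 < C -> pos_dmeas sigma ->
  (forall g, wsum sigma (fun y => wsum omega (fun x => k x y * g x) ^+ 2)
     <= C * wsum omega (fun x => g x ^+ 2)) ->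
  forall f, wsum omega (fun x => wsum sigma (fun y => k x y * f y) ^+ 2)
     <= C * wsum sigma (fun y => f y ^+ 2).
Proof.
move=> C0 sigma0 adj f; set h := fun x => wsum sigma (fun y => k x y * f y).
set S := wsum omega _; have {}adj := adj h.
have SE : S = wsum sigma (fun y => f y * wsum omega (fun x => k x y * h x)).
  rewrite /S {1}/wsum.
  under eq_bigr => q _ do rewrite expr2 -/(h q.1) {1}/h /wsum mulr_suml mulr_sumr.
  rewrite exchange_big /=; apply: eq_bigr => q _.
  rewrite /wsum !mulr_sumr; apply: eq_bigr => x _; ring.
have : S <= 2^-1 * (C * wsum sigma (fun y => f y ^+ 2) +
     C^-1 * wsum sigma (fun y => wsum omega (fun x => k x y * h x) ^+ 2)).
  rewrite SE -!wsumZ -wsumD -wsumZ; apply: le_wsum => // q _ /=.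
  set a := f _; set b := wsum _ _.
  have : 0 <= C^-1 * (C * a - b) ^+ 2 by rewrite mulr_ge0 ?sqr_ge0 ?invr_ge0 ?ltW.
  have -> : C^-1 * (C * a - b) ^+ 2 = C * a ^+ 2 + C^-1 * b ^+ 2 - 2 * (a * b).
    by field; rewrite gt_eqF.
  lra.
(* This is the hypothesis at [h]; half of [S] is then absorbed into the left side. *)
have : C^-1 * wsum sigma (fun y => wsum omega (fun x => k x y * h x) ^+ 2) <= S.
  by rewrite ler_pdivrMl.
lra.
Qed.

End WeightedSums.

(** * The self-similar pairs of measures *)

Section SelfSimilarMeasures.
Context {R : realType} {n : nat}.
Variables (tau ts : R) (rounded_center : bool * bool -> pt R n) (zm zp : pt R n).
Implicit Types (g : pt R n -> R).

Definition phi_map e (x : pt R n) : pt R n := rounded_center e + tau *: x.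

Fixpoint omegaN N : dmeas R n := if N is N'.+1 then
  [seq (phi_map e q.1, 4^-1 * q.2) | e <- enum {: bool * bool}, q <- omegaN N']
  else [:: (0, 1)].

(** [ts] stands for tau^s. The field of a child, of weight 1/4 and scale tau, carries the factor (4
    * ts)^-1; the weight 4 * ts ^+ 2 turns the square of this factor into 1/4, the omega-mass of the
    child. *)
Fixpoint sigmaN N : dmeas R n := if N is N'.+1 then
  [:: (zm, 1); (zp, 1)] ++
  [seq (phi_map e q.1, (4 * ts ^+ 2) * q.2) | e <- enum {: bool * bool}, q <- sigmaN N']
  else [::].

Lemma wsum_omegaS N g :
  wsum (omegaN N.+1) g = \sum_e 4^-1 * wsum (omegaN N) (g \o phi_map e).
Proof.
rewrite /wsum /= big_allpairs_dep big_enum /=; apply: eq_bigr => e _.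
by rewrite mulr_sumr; apply: eq_bigr => q _; rewrite mulrA.
Qed.

Lemma wsum_sigmaS N g :
  wsum (sigmaN N.+1) g = g zm + g zp +
    \sum_e (4 * ts ^+ 2) * wsum (sigmaN N) (g \o phi_map e).
Proof.
rewrite /wsum /= !big_cons /= !mul1r addrA; congr (_ + _).
rewrite big_allpairs_dep big_enum /=; apply: eq_bigr => e _.
by rewrite mulr_sumr; apply: eq_bigr => q _; rewrite mulrA.
Qed.

Lemma sum_quarter (a : R) : \sum_(e : bool * bool) 4^-1 * a = a.
Proof. by rewrite sumr_const card_prod card_bool -[LHS]mulr_natl mulrA mulfV ?mul1r ?pnatr_eq0. Qed.

Lemma omegaN_mass N : wsum (omegaN N) (cst 1) = 1.
Proof.
elim: N => [|N IH]; first by rewrite /wsum big_seq1 mulr1.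
rewrite wsum_omegaS -[RHS]sum_quarter; apply: eq_bigr => e _.
by rewrite (_ : _ \o _ = cst 1)// IH.
Qed.

Lemma omegaN_pos N : pos_dmeas (omegaN N).
Proof.
elim: N => [|N IH] q /=; first by rewrite inE => /eqP ->.
move=> /allpairsP[[e x] [_ xw ->]] /=.
by rewrite mulr_gt0 ?invr_gt0// IH.
Qed.

Lemma sigmaN_pos N : 0 < ts -> pos_dmeas (sigmaN N).
Proof.
move=> ts0; elim: N => [//|N IH] q /=; rewrite !inE => /or3P[/eqP->|/eqP->|]//.
move=> /allpairsP[[e x] [_ xw ->]] /=.
by rewrite !mulr_gt0 ?exprn_gt0// IH.
Qed.

(** The mass satisfies m' = 2 + 16 * ts ^+ 2 * m, and the bound 3 is stable under this recursion
    because 16 * ts ^+ 2 <= 1/3. *)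
Lemma sigmaN_mass N : 48 * ts ^+ 2 <= 1 -> wsum (sigmaN N) (cst 1) <= 3.
Proof.
move=> tsmall; elim: N => [|N IH]; first by rewrite /wsum big_nil.
rewrite wsum_sigmaS.
rewrite (eq_bigr (fun e => 4^-1 * (16 * ts ^+ 2 * wsum (sigmaN N) (cst 1)))); last first.
  by move=> e _; rewrite (_ : _ \o _ = cst 1)//; field.
rewrite sum_quarter /=.
have := ler_wpM2l (_ : 0 <= 16 * ts ^+ 2) IH.
by rewrite mulr_ge0 ?sqr_ge0// => /(_ isT); lra.
Qed.

(** The interval [[k1, k2]] is meant to contain the distances between the two sigma-points of the
    root and the omega-points. *)
Definition cut_at (k1 k2 delta : R) : R := (k1 <= delta <= k2)%R%:R.

(* The number of generations whose range of distances contains the radius delta. *)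
Fixpoint ncut (k1 k2 : R) N (delta : R) : R :=
  if N is N'.+1 then cut_at k1 k2 delta + ncut k1 k2 N' (delta / tau) else 0.

(** Descending a generation divides the radius by tau < 1, so a radius beyond the range stays beyond
    it. *)
Lemma ncut0 k1 k2 N delta : 0 < tau -> tau < 1 -> 0 <= k2 -> k2 < delta ->
  ncut k1 k2 N delta = 0.
Proof.
move=> t0 t1 k20; elim: N delta => //= N IH delta k2d.
rewrite IH /cut_at; last by rewrite ltr_pdivlMr// (le_lt_trans _ k2d)// ler_piMr// ltW.
by rewrite (leNgt delta) k2d andbF/= addr0.
Qed.

(** If a generation is cut, the next radius delta / tau exceeds [k2] because tau * k2 < k1, and no
    later generation is cut. *)
Lemma ncut_le1 k1 k2 N delta : 0 < tau -> tau < 1 -> 0 <= k2 -> tau * k2 < k1 ->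
  ncut k1 k2 N delta <= 1.
Proof.
move=> t0 t1 k20 tk; elim: N delta => //= N IH delta.
rewrite /cut_at; case: (boolP (k1 <= delta <= k2)) => [/andP[k1d dk2]|_] /=; last by rewrite add0r.
by rewrite ncut0 ?addr0// ltr_pdivlMr// mulrC (lt_le_trans tk).
Qed.

End SelfSimilarMeasures.

(** * Induction on the number of generations for the adjoint operator *)

Section AdjointBound.
Context {R : realType} {n : nat}.
Variables (tau ts : R) (rounded_center : bool * bool -> pt R n) (zm zp : pt R n).
(** The kernel is abstract here. [child_kernel z e] is its value when child [e] is shrunk to a
    point, [e1] the error of this replacement when the truncation does not interfere, and [C0]
    bounds the kernel between separated pieces. *)
Variables (K : R -> R -> pt R n -> R) (child_kernel : pt R n -> bool * bool -> R).
Variables (C0 e1 k1 k2 : R) (Box : set (pt R n)).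
Local Notation phi := (phi_map tau rounded_center).
Local Notation omegaN := (omegaN tau rounded_center).
Local Notation sigmaN := (sigmaN tau ts rounded_center zm zp).
Implicit Types (g : pt R n -> R) (e : bool * bool) (a : bool * bool -> R) (z : pt R n).

Hypotheses (ts0 : 0 < ts) (ts1 : 48 * ts ^+ 2 <= 1) (C00 : 0 <= C0).
Hypotheses (Box0 : Box 0) (Boxz : forall z, z \in [:: zm; zp] -> Box z).
Hypothesis Boxphi : forall e x, Box x -> Box (phi e x).
Hypothesis Kscale : forall delta R0 v,
  K delta R0 (tau *: v) = ts^-1 * K (delta / tau) (R0 / tau) v.
Hypothesis Kcross : forall delta R0 e e' x y, e != e' -> Box x -> Box y ->
  `|K delta R0 (phi e x - phi e' y)| <= C0.
Hypothesis Ktop : forall delta R0 e x z, z \in [:: zm; zp] -> Box x ->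
  `|K delta R0 (phi e x - z)| <= C0.
Hypothesis kap0 : forall z, z \in [:: zm; zp] -> \sum_e child_kernel z e = 0.
Hypothesis kap_le : forall z e, z \in [:: zm; zp] -> `|child_kernel z e| <= C0.
Hypothesis Kin : forall delta R0 e x z, z \in [:: zm; zp] -> Box x ->
  delta < k1 -> k2 < R0 -> `|K delta R0 (phi e x - z) - child_kernel z e| <= e1.
Hypothesis Kout : forall delta R0 e x z, z \in [:: zm; zp] -> Box x ->
  k2 < delta \/ R0 < k1 -> K delta R0 (phi e x - z) = 0.

Lemma Box_omegaN N q : q \in omegaN N -> Box q.1.
Proof.
elim: N q => [|N IH] q /=; first by rewrite inE => /eqP ->.
by move=> /allpairsP[[e x] [_ /IH xw ->]]; exact: Boxphi.
Qed.

Lemma Box_sigmaN N q : q \in sigmaN N -> Box q.1.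
Proof.
elim: N q => [//|N IH] q /=; rewrite !inE => /or3P[/eqP->|/eqP->|].
- by apply: Boxz; rewrite !inE eqxx.
- by apply: Boxz; rewrite !inE eqxx orbT.
by move=> /allpairsP[[e x] [_ /IH xw ->]]; exact: Boxphi.
Qed.

Definition variance (a : bool * bool -> R) : R :=
  \sum_e 4^-1 * a e ^+ 2 - (\sum_e 4^-1 * a e) ^+ 2.

Lemma varianceE a :
  variance a = \sum_e 4^-1 * (a e - \sum_e' 4^-1 * a e') ^+ 2.
Proof.
rewrite /variance; set m := \sum_e _ * a _.
transitivity (\sum_e (4^-1 * a e ^+ 2 + (- 2 * m * (4^-1 * a e) + 4^-1 * m ^+ 2))).
  by rewrite !big_split /= sum_quarter -[X in _ + (X + _)]mulr_sumr -/m; ring.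
by apply: eq_bigr => e _; ring.
Qed.

Lemma variance_ge0 a : 0 <= variance a.
Proof.
by rewrite varianceE; apply: sumr_ge0 => e _; rewrite mulr_ge0 ?sqr_ge0 ?invr_ge0.
Qed.

Lemma sqr_mean_le a : (\sum_e 4^-1 * a e) ^+ 2 <= \sum_e 4^-1 * a e ^+ 2.
Proof. by have := variance_ge0 a; rewrite /variance subr_ge0. Qed.

Lemma sqr_norm_le (x C : R) : `|x| <= C -> x ^+ 2 <= C ^+ 2.
Proof.
move=> xC; rewrite -real_normK ?num_real// lerXn2r ?nnegrE//.
by rewrite (le_trans _ xC).
Qed.

(** Since the [k e] sum to zero, the mean of [a] may be subtracted; Jensen then leaves the variance.
    This is where the balanced configuration pays off. *)
Lemma sqr_cancel_le (k a : bool * bool -> R) : \sum_e k e = 0 ->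
  (forall e, `|k e| <= C0) ->
  (\sum_e 4^-1 * (k e * a e)) ^+ 2 <= C0 ^+ 2 * variance a.
Proof.
move=> ksum kle; set m := \sum_e 4^-1 * a e.
have -> : \sum_e 4^-1 * (k e * a e) = \sum_e 4^-1 * (k e * (a e - m)).
  transitivity (\sum_e (4^-1 * (k e * (a e - m)) + 4^-1 * m * k e)).
    by apply: eq_bigr => e _; ring.
  by rewrite big_split /= -[X in _ + X]mulr_sumr ksum mulr0 addr0.
apply: le_trans (sqr_mean_le _) _.
rewrite varianceE mulr_sumr; apply: ler_sum => e _.
rewrite [leRHS]mulrCA ler_pM2l ?invr_gt0// exprMn ler_wpM2r ?sqr_ge0//.
exact: sqr_norm_le.
Qed.

Lemma sqrD_le2 (a b : R) : (a + b) ^+ 2 <= 2 * a ^+ 2 + 2 * b ^+ 2.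
Proof. by have := sqr_ge0 (a - b); nra. Qed.

(** The factor of the main term can be kept as close to 1 as desired, which matters because it is
    iterated over N generations. *)
Lemma sqrD_le (th a b : R) : 0 < th ->
  (a + b) ^+ 2 <= (1 + th) * a ^+ 2 + (1 + th^-1) * b ^+ 2.
Proof.
move=> th0; rewrite -subr_ge0.
have -> : (1 + th) * a ^+ 2 + (1 + th^-1) * b ^+ 2 - (a + b) ^+ 2 =
  th^-1 * (th * a - b) ^+ 2 by field; rewrite gt_eqF.
by rewrite mulr_ge0 ?sqr_ge0 ?invr_ge0 ?ltW.
Qed.

Local Notation nrm N g := (wsum (omegaN N) (fun x => g x ^+ 2)).

Lemma nrm_ge0 N g : 0 <= nrm N g.
Proof. by apply: wsum_ge0 => [|q _]; [exact: omegaN_pos|exact: sqr_ge0]. Qed.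

(** Three cases. If a radius lies in [[k1, k2]], the crude bound is paid for by the cut terms; if
    the truncation removes the whole range, the field vanishes; otherwise the kernel is constant on
    each child up to [e1], and the cancellation leaves the variance. *)
Lemma top_le N delta R0 g z : z \in [:: zm; zp] ->
  wsum (omegaN N.+1) (fun x => K delta R0 (x - z) * g x) ^+ 2 <=
  2 * C0 ^+ 2 * variance (fun e => wsum (omegaN N) (g \o phi e)) +
  (2 * e1 ^+ 2 + C0 ^+ 2 * (cut_at k1 k2 delta + cut_at k1 k2 R0)) * nrm N.+1 g.
Proof.
move=> zz; set V := variance _; set W := wsum _ _; set M := wsum _ _.
have V0 : 0 <= 2 * C0 ^+ 2 * V.
  by rewrite mulr_ge0 ?variance_ge0// mulr_ge0 ?sqr_ge0.
have M0 : 0 <= M by exact: nrm_ge0.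
have e10 : 0 <= 2 * e1 ^+ 2 by rewrite mulr_ge0 ?sqr_ge0.
have C02 : 0 <= C0 ^+ 2 by rewrite sqr_ge0.
have [/norP[ndel nR]|] := boolP (~~ ((k1 <= delta <= k2) || (k1 <= R0 <= k2))); last first.
  rewrite negbK => hcut.
  have WM : W ^+ 2 <= C0 ^+ 2 * M.
    apply: wsum_norm_le; [exact: omegaN_pos|exact: omegaN_mass|].
    by move=> q /allpairsP[[e x] [_ /Box_omegaN xB ->]] /=; exact: Ktop.
  have : 1 <= cut_at k1 k2 delta + cut_at k1 k2 R0.
    by rewrite /cut_at; case/orP: hcut => ->; rewrite ?[true%:R]/(1 : R) (lerDl, lerDr) ler0n.
  set c := cut_at _ _ _ + _ => c1.
  have := mulr_ge0 e10 M0.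
  have : C0 ^+ 2 * M <= C0 ^+ 2 * c * M.
    by rewrite ler_wpM2r// ler_peMr.
  rewrite (mulrDl (2 * e1 ^+ 2)); lra.
rewrite /cut_at (negbTE ndel) (negbTE nR) /= addr0 mulr0 addr0.
have [out|] := pselect (k2 < delta \/ R0 < k1).
  have -> : W = 0.
    rewrite /W /wsum big_seq big1// => q /allpairsP[[e x] [_ /Box_omegaN xB ->]] /=.
    by rewrite Kout// mul0r mulr0.
  by rewrite expr0n addr_ge0// mulr_ge0.
move=> /not_orP[/negP ndel2 /negP nR1].
have delk : delta < k1.
  by rewrite ltNge; apply: contra ndel => ->; rewrite leNgt.
have kR : k2 < R0.
  by rewrite ltNge; apply: contra nR => ->; rewrite leNgt nR1.
(* [X e] is the error made by freezing the kernel at its value for child [e]. *)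
pose X e := wsum (omegaN N) (fun x => (K delta R0 (phi e x - z) - child_kernel z e) * g (phi e x)).
have -> : W = \sum_e 4^-1 * (child_kernel z e * wsum (omegaN N) (g \o phi e)) + \sum_e 4^-1 * X e.
  rewrite /W wsum_omegaS -big_split; apply: eq_bigr => e _ /=.
  rewrite -mulrDr; congr (_ * _); rewrite -wsumZ -wsumD.
  by apply: eq_wsum => q _ /=; ring.
apply: le_trans (sqrD_le2 _ _) _; rewrite -[2 * _ * V]mulrA -[2 * _ * M]mulrA lerD// ler_pM2l//.
  by apply: sqr_cancel_le; [exact: kap0 | move=> e; exact: kap_le].
apply: le_trans (sqr_mean_le _) _.
rewrite /M wsum_omegaS mulr_sumr; apply: ler_sum => e _.
rewrite [leRHS]mulrCA ler_pM2l ?invr_gt0//.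
apply: (@wsum_norm_le _ _ (omegaN N) (g \o phi e) (fun x => K delta R0 (phi e x - z) - child_kernel z e)).
- exact: omegaN_pos.
- exact: omegaN_mass.
- by move=> q /Box_omegaN qB; exact: Kin.
Qed.

(** Child [e] sees itself through a rescaled copy of the problem, with factor (4 * ts)^-1; the three
    other children are separated from it and are bounded crudely. *)
Lemma cross_le N delta R0 g e y th : 0 < th -> Box y ->
  wsum (omegaN N.+1) (fun x => K delta R0 (x - phi e y) * g x) ^+ 2 <=
  (1 + th) * (16^-1 * ts ^- 2 *
     wsum (omegaN N) (fun x => K (delta / tau) (R0 / tau) (x - y) * g (phi e x)) ^+ 2) +
  (1 + th^-1) * (C0 ^+ 2 * nrm N.+1 g).
Proof.
move=> th0 yB; rewrite wsum_omegaS (bigD1 e)//=.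
(* With a zero in place of the term [e], the remaining part is a mean over all four children, to
   which Jensen applies. *)
pose X e' := if e' == e then 0 else
  wsum (omegaN N) (fun x => K delta R0 (phi e' x - phi e y) * g (phi e' x)).
have -> : \sum_(i | i != e) 4^-1 * wsum (omegaN N)
    ((fun x => K delta R0 (x - phi e y) * g x) \o phi i) = \sum_i 4^-1 * X i.
  rewrite [RHS](bigD1 e)//= /X eqxx mulr0 add0r; apply: eq_bigr => i ie.
  by rewrite (negbTE ie).
apply: le_trans (sqrD_le _ _ th0) _; apply: lerD.
  rewrite ler_pM2l ?addr_gt0//.
  rewrite (@eq_wsum _ _ _ _ (fun x => ts^-1 *
     (K (delta / tau) (R0 / tau) (x - y) * g (phi e x)))); last first.
    move=> q _ /=; rewrite mulrA -Kscale; congr (K _ _ _ * _).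
    by rewrite /phi_map scalerBr opprD addrACA subrr add0r.
  rewrite wsumZ; set W := wsum _ _.
  have -> : (4^-1 * (ts^-1 * W)) ^+ 2 = 16^-1 * ts ^- 2 * W ^+ 2; last by [].
  by field; rewrite gt_eqF.
rewrite ler_pM2l ?addr_gt0 ?invr_gt0//.
apply: le_trans (sqr_mean_le _) _.
rewrite wsum_omegaS mulr_sumr; apply: ler_sum => i _.
rewrite [leRHS]mulrCA ler_pM2l ?invr_gt0// /X.
case: eqVneq => [_|ie]; first by rewrite expr0n mulr_ge0 ?sqr_ge0//= (nrm_ge0 N (g \o phi i)).
apply: (@wsum_norm_le _ _ (omegaN N) (g \o phi i) (fun x => K delta R0 (phi i x - phi e y))).
- exact: omegaN_pos.
- exact: omegaN_mass.
- by move=> q /Box_omegaN qB; exact: Kcross.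
Qed.

(* The variance splits over the generations, which makes the sum over the tree telescope. *)
Lemma adjoint_induction N delta R0 g th : 0 < th ->
  wsum (sigmaN N) (fun y => wsum (omegaN N) (fun x => K delta R0 (x - y) * g x) ^+ 2)
  <= (1 + th) ^+ N * (4 * C0 ^+ 2 * (nrm N g - wsum (omegaN N) g ^+ 2) +
       (2 * C0 ^+ 2 * (ncut tau k1 k2 N delta + ncut tau k1 k2 N R0) +
        N%:R * (4 * e1 ^+ 2 + (1 + th^-1) * (48 * ts ^+ 2 * C0 ^+ 2))) * nrm N g).
Proof.
move=> th0; set ee := 4 * e1 ^+ 2 + _.
elim: N delta R0 g => [|N IH] delta R0 g.
  (* There are no sigma-points, and the right-hand side is nonnegative by Jensen. *)
  rewrite {1}/wsum big_nil expr0 mul1r /= addr0 mulr0 mul0r addr0 mul0r addr0.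
  rewrite mulr_ge0 ?mulr_ge0 ?sqr_ge0// subr_ge0 wsum_jensen//.
    exact: (@omegaN_pos _ _ tau rounded_center 0).
  exact: (@omegaN_mass _ _ tau rounded_center 0).
rewrite wsum_sigmaS.
have zmz : zm \in [:: zm; zp] by rewrite !inE eqxx.
have zpz : zp \in [:: zm; zp] by rewrite !inE eqxx orbT.
have /(_ zm zmz) topm := @top_le N delta R0 g.
have /(_ zp zpz) topp := @top_le N delta R0 g.
set a := fun e => wsum (omegaN N) (g \o phi e) in topm topp *.
set M := nrm N.+1 g in topm topp *.
set ct := cut_at _ _ _ + _ in topm topp *.
set cn := ncut tau k1 k2 N (delta / tau) + ncut tau k1 k2 N (R0 / tau).
have M0 : 0 <= M by exact: nrm_ge0.
set S := \sum_e _.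
(* [S] gathers the sigma-points of the four subtrees; [topm] and [topp] cover the two points of the
   root. *)
have SE : S <= (1 + th) ^+ N.+1 * (4 * C0 ^+ 2 * (M - \sum_e 4^-1 * a e ^+ 2) +
     (2 * C0 ^+ 2 * cn + N%:R * ee) * M) + (1 + th^-1) * (48 * ts ^+ 2 * C0 ^+ 2) * M.
  pose G e := nrm N (g \o phi e).
  have ME : M = \sum_e 4^-1 * G e by rewrite /M wsum_omegaS.
  set Y := (1 + th) ^+ N.+1; set c3 := (1 + th^-1) * _.
  have -> : Y * (4 * C0 ^+ 2 * (M - \sum_e 4^-1 * a e ^+ 2) +
      (2 * C0 ^+ 2 * cn + N%:R * ee) * M) + c3 * M =
    \sum_e (4^-1 * (Y * (4 * C0 ^+ 2 * (G e - a e ^+ 2) +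
      (2 * C0 ^+ 2 * cn + N%:R * ee) * G e)) + 4^-1 * (c3 * M)).
    rewrite big_split /= sum_quarter {1 2}ME; congr (_ + _).
    transitivity (\sum_e (Y * (4 * C0 ^+ 2 + (2 * C0 ^+ 2 * cn + N%:R * ee)) * (4^-1 * G e)
       + (- (Y * (4 * C0 ^+ 2))) * (4^-1 * a e ^+ 2))).
      by rewrite big_split /= -!mulr_sumr; ring.
    by apply: eq_bigr => e _; ring.
  apply: ler_sum => e _.
  have {}IH := IH (delta / tau) (R0 / tau) (g \o phi e).
  have sig0 := @sigmaN_pos _ _ tau _ rounded_center zm zp N ts0.
  apply: (@le_trans _ _ (4 * ts ^+ 2 * wsum (sigmaN N) (fun y =>
    (1 + th) * (16^-1 * ts ^- 2 *
     wsum (omegaN N) (fun x => K (delta / tau) (R0 / tau) (x - y) * g (phi e x)) ^+ 2) +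
      ((1 + th^-1) * (C0 ^+ 2 * M)) * cst 1 y))).
    rewrite ler_wpM2l ?mulr_ge0 ?(ltW ts0)//; apply: le_wsum => // q /Box_sigmaN qB.
    by rewrite /= mulr1; exact: cross_le.
  rewrite wsumD !wsumZ; set X := wsum _ _ in IH *; set m := wsum _ (cst 1).
  (* The sigma-weight 4 * ts ^+ 2 cancels the scaling factor of the kernel and leaves 1/4. *)
  have -> : 4 * ts ^+ 2 * ((1 + th) * (16^-1 * ts ^- 2 * X) +
      (1 + th^-1) * (C0 ^+ 2 * M) * m) =
     4^-1 * ((1 + th) * X) + 4 * ts ^+ 2 * ((1 + th^-1) * (C0 ^+ 2 * M)) * m.
    by field; rewrite !gt_eqF.
  apply: lerD.
    rewrite ler_pM2l ?invr_gt0// /Y exprS -[leRHS]mulrA ler_pM2l ?addr_gt0//.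
  (* The error is constant in [y], so it is multiplied by the sigma-mass, at most 3; the constant 48
     is 4 * 4 * 3, one 4 being the weight and the other compensating 1/4. *)
  have c0 : 0 <= 4 * ts ^+ 2 * ((1 + th^-1) * (C0 ^+ 2 * M)).
    by rewrite !mulr_ge0 ?sqr_ge0 ?addr_ge0 ?invr_ge0// ltW.
  have := ler_wpM2l c0 (@sigmaN_mass _ _ tau _ rounded_center zm zp N ts1).
  move=> /le_trans; apply; rewrite le_eqVlt; apply/orP; left; apply/eqP.
  by rewrite /c3; field; rewrite gt_eqF.
set Y := (1 + th) ^+ N.+1 in SE *.
have Y1 : 1 <= Y by rewrite exprn_ege1// lerDl ltW.
have -> : wsum (omegaN N.+1) g = \sum_e 4^-1 * a e by rewrite wsum_omegaS.
rewrite /= -/M -addrACA -/ct -/cn.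
(* [D] bounds the contribution of the two root points. Adding its variance to the terms of the
   children turns the mean of the squared child means into the square of the global mean. *)
set D := 4 * C0 ^+ 2 * variance a + (2 * C0 ^+ 2 * ct + ee) * M.
have ct0 : 0 <= ct by rewrite addr_ge0.
have D0 : 0 <= D.
  have thV0 : 0 <= th^-1 by rewrite invr_ge0 ltW.
  by rewrite /D /ee; do ?[exact: sqr_ge0 | exact: variance_ge0 | exact: ler0n
    | assumption | apply: addr_ge0 | apply: mulr_ge0].
have YD : D <= Y * D by rewrite ler_peMl.
apply: (@le_trans _ _ (D + Y * (4 * C0 ^+ 2 * (M - \sum_e 4^-1 * a e ^+ 2) +
     (2 * C0 ^+ 2 * cn + N%:R * ee) * M))).
  rewrite {1}/D /ee; move: SE topm topp; set z1 := _ ^+ 2; set z2 := _ ^+ 2.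
  set U := Y * _; lra.
apply: (le_trans (lerD YD (lexx _))).
rewrite -mulrDr le_eqVlt; apply/orP; left; apply/eqP; congr (_ * _).
by rewrite /D /variance -[N.+1]addn1 natrD; ring.
Qed.

End AdjointBound.

(** * The truncated kernel *)

Section Enorm.
Context {R : realType} {n : nat}.
Implicit Types (v : pt R n).

Lemma enorm_ge0 v : 0 <= enorm v. Proof. exact: sqrtr_ge0. Qed.

Lemma sumsq_ge0 v : 0 <= \sum_(i < n) v ord0 i ^+ 2.
Proof. by apply: sumr_ge0 => i _; exact: sqr_ge0. Qed.

Lemma sqr_enorm v : enorm v ^+ 2 = \sum_(i < n) v ord0 i ^+ 2.
Proof. by rewrite sqr_sqrtr ?sumsq_ge0. Qed.

Lemma enormZ (c : R) v : 0 <= c -> enorm (c *: v) = c * enorm v.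
Proof.
move=> c0; rewrite /enorm (eq_bigr (fun i => c ^+ 2 * v ord0 i ^+ 2)); last first.
  by move=> i _; rewrite mxE exprMn.
by rewrite -mulr_sumr sqrtrM ?sqr_ge0// sqrtr_sqr ger0_norm.
Qed.

Lemma coord_le_enorm v i : `|v ord0 i| <= enorm v.
Proof.
rewrite -sqrtr_sqr ler_wsqrtr// (bigD1 i)//= lerDl.
by apply: sumr_ge0 => k _; exact: sqr_ge0.
Qed.

Lemma enorm_le v (c : R) : (forall i, `|v ord0 i| <= c) -> enorm v <= n%:R * c.
Proof.
move=> vc; have [n0|n0] := posnP n.
  by rewrite /enorm big1 ?sqrtr0 ?n0 ?mul0r// => i; exfalso; move: i; rewrite n0 => -[].
have c0 : 0 <= c by apply: le_trans (vc (Ordinal n0)).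
rewrite -(ler_pXn2r (_ : 0 < 2)%N) ?nnegrE ?enorm_ge0 ?mulr_ge0//.
rewrite sqr_enorm (@le_trans _ _ (\sum_(i < n) c ^+ 2))//.
  by apply: ler_sum => i _; exact: sqr_norm_le.
rewrite sumr_const card_ord -[leLHS]mulr_natl exprMn ler_wpM2r ?sqr_ge0//.
by rewrite expr2 ler_peMl// ler1n.
Qed.

Lemma enorm_gt0 v i : v ord0 i != 0 -> 0 < enorm v.
Proof. by rewrite -normr_gt0 => /lt_le_trans; apply; exact: coord_le_enorm. Qed.

Lemma sumsq_continuous (r : seq 'I_n) :
  continuous (fun v : pt R n => \sum_(i <- r) v ord0 i ^+ 2).
Proof.
elim: r => [|i r IH] v.
  rewrite (_ : (fun _ => _) = cst 0); first exact: (@cst_continuous (pt R n) R).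
  by apply/funext => w; rewrite big_nil.
rewrite (_ : (fun _ => _) = (fun w : pt R n => w ord0 i * w ord0 i + \sum_(k <- r) w ord0 k ^+ 2)).
  have co : {for v, continuous (fun w : pt R n => w ord0 i)} by exact: coord_continuous.
  exact: (continuousD (continuousM co co) (IH v)).
by apply/funext => w; rewrite big_cons.
Qed.

Lemma enorm_continuous : continuous (@enorm R n).
Proof.
move=> v; apply: (@continuous_comp _ _ _
  (fun v : pt R n => \sum_(i < n) v ord0 i ^+ 2) (@Num.sqrt R)).
  exact: sumsq_continuous.
exact: sqrt_continuous.
Qed.

End Enorm.

Section Kernel.
Context {R : realType} {n : nat}.
Variable (s : R).
Hypothesis s0 : 0 < s.
Implicit Types (v : pt R n) (j : 'I_n).

(** Component [j] of the kernel, with [s] standing for n - alpha: homogeneous of degree -s. *)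
Definition riesz_kernel j v : R := v ord0 j / powR (enorm v) (s + 1).
Definition trunc_kernel j (delta R0 : R) v : R := Defs.eta delta R0 (enorm v) * riesz_kernel j v.

Lemma powR_s1 (x : R) : 0 <= x -> powR x (s + 1) = x * powR x s.
Proof. by move=> x0; rewrite -(mulr_powRB1 x0) ?addrK// addr_gt0. Qed.

(** Homogeneity of degree -s; the truncation depends on the length only, so both radii are
    rescaled. *)
Lemma trunc_kernel_scale j (tau delta R0 : R) v : 0 < tau ->
  trunc_kernel j delta R0 (tau *: v) = (powR tau s)^-1 * trunc_kernel j (delta / tau) (R0 / tau) v.
Proof.
move=> t0; rewrite /trunc_kernel /riesz_kernel enormZ ?(ltW t0)// /Defs.eta ler_pdivrMr// ler_pdivlMr//.
rewrite (mulrC tau) mxE powRM ?enorm_ge0 ?(ltW t0)// (powR_s1 (ltW t0)) !invfM.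
have -> : tau * v ord0 j * ((powR (enorm v) (s + 1))^-1 * (tau^-1 * (powR tau s)^-1))
  = (tau * tau^-1) * ((powR tau s)^-1 * (v ord0 j / powR (enorm v) (s + 1))) by ring.
by rewrite mulfV ?gt_eqF// mul1r mulrCA.
Qed.

Lemma riesz_kernel_le j v (kappa : R) : 0 < kappa -> kappa <= enorm v ->
  `|riesz_kernel j v| <= (powR kappa s)^-1.
Proof.
move=> k0 kv; have v0 := lt_le_trans k0 kv.
rewrite /riesz_kernel normrM normfV (ger0_norm (powR_ge0 _ _)) powR_s1 ?enorm_ge0// invfM mulrA.
rewrite -[leRHS]mul1r ler_pM ?mulr_ge0 ?invr_ge0 ?powR_ge0 ?enorm_ge0//.
  by rewrite ler_pdivrMr// mul1r coord_le_enorm.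
by rewrite lef_pV2 ?posrE ?powR_gt0// ge0_ler_powR ?nnegrE ?(ltW k0) ?(ltW v0) ?(ltW s0).
Qed.

Lemma trunc_kernel_le j delta R0 v (kappa : R) : 0 < kappa -> kappa <= enorm v ->
  `|trunc_kernel j delta R0 v| <= (powR kappa s)^-1.
Proof.
move=> k0 kv; apply: le_trans (riesz_kernel_le j k0 kv); rewrite /trunc_kernel /Defs.eta.
by case: ifP => _; rewrite ?mul1r// mul0r normr0.
Qed.

Lemma powR_continuous_gt0 (p x : R) : 0 < x -> {for x, continuous (fun y : R => powR y p)}.
Proof.
move=> x0; have H : expR (p * ln y) @[y --> x] --> expR (p * ln x).
  apply: (@continuous_comp _ _ _ (fun y => p * ln y) expR); last exact: continuous_expR.
  by apply: cvgM; [exact: cvg_cst|exact: continuous_ln].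
rewrite /prop_for /continuous_at {2}/powR gt_eqF//.
apply: cvg_trans H; apply: near_eq_cvg; near=> y.
by rewrite /powR gt_eqF//; near: y; exact: lt_nbhsr.
Unshelve. all: by end_near. Qed.

Lemma riesz_kernel_continuous j v : 0 < enorm v -> {for v, continuous (riesz_kernel j)}.
Proof.
move=> v0.
have co : {for v, continuous (fun w : pt R n => w ord0 j)} by exact: coord_continuous.
have pc : {for v, continuous (fun w : pt R n => powR (enorm w) (s + 1))}.
  apply: (@continuous_comp _ _ _ (@enorm R n) (fun y : R => powR y (s + 1))).
    exact: enorm_continuous.
  exact: powR_continuous_gt0.
apply: (continuousM co); apply: (continuousV _ pc).
by rewrite gt_eqF// powR_gt0.
Qed.

(** Continuity at finitely many points, with one radius for all of them and for all components. *)
Lemma riesz_kernel_unif (T : finType) (w : T -> pt R n) (e : R) : 0 < e ->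
  (forall t, 0 < enorm (w t)) ->
  exists2 rho : R, 0 < rho & forall t j v, (forall i, `|v ord0 i - w t ord0 i| < rho) ->
    `|riesz_kernel j v - riesz_kernel j (w t)| <= e.
Proof.
move=> e0 w0.
have H : \forall rho \near (0 : R)^'+, forall tj : T * 'I_n,
    forall v, (forall i, `|v ord0 i - w tj.1 ord0 i| < rho) ->
    `|riesz_kernel tj.2 v - riesz_kernel tj.2 (w tj.1)| <= e.
  apply: filter_forall => -[t j] /=.
  have /cvgrPdist_le/(_ _ e0) := @riesz_kernel_continuous j (w t) (w0 t).
  move=> /nbhs_ballP[r /= r0 rP]; near=> rho => v vr.
  rewrite distrC; apply: rP; split => // i k; rewrite ord1 /ball /= distrC.
  apply: lt_le_trans (vr k) _.
  by near: rho; exact: nbhs_right_le.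
have H1 : \forall rho \near (0 : R)^'+, 0 < rho /\ forall (tj : T * 'I_n) v,
    (forall i, `|v ord0 i - w tj.1 ord0 i| < rho) ->
    `|riesz_kernel tj.2 v - riesz_kernel tj.2 (w tj.1)| <= e.
  by near=> rho; split; near: rho; [exact: nbhs_right_gt|exact: H].
have [rho [rho0 HP]] := filter_ex H1.
by exists rho => // t j; exact: (HP (t, j)).
Unshelve. all: by end_near. Qed.

End Kernel.

(** * The balanced configuration *)

(** With mu = (1 + d) / (1 - d), the equation says that the two sums of squares have ratio lam =
    mu^(2/p). This is linear in b^2, and its solution is positive because 1 < lam < mu^2, where the
    second inequality comes from p > 1. *)
Lemma exists_balanced (R : realType) (d p : R) : 0 < d -> d < 1 -> 1 < p ->
  exists2 b : R, 0 < b &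
    (1 + d) / powR (Num.sqrt ((1 + d) ^+ 2 + b ^+ 2)) p =
    (1 - d) / powR (Num.sqrt ((1 - d) ^+ 2 + b ^+ 2)) p.
Proof.
move=> d0 d1 p1; pose mu := (1 + d) / (1 - d); pose lam := powR mu (2 / p).
have dp : 0 < 1 - d by lra.
have p0 : 0 < p by lra.
have mu1 : 1 < mu by rewrite ltr_pdivlMr//; lra.
have mu0 : 0 < mu by lra.
have lam1 : 1 < lam.
  have := @gt0_ltr_powR R (2 / p) (divr_gt0 _ p0) 1 mu.
  by rewrite powR1 !nnegrE; apply => //; exact: ltW.
have lamp : powR lam p = mu ^+ 2.
  by rewrite /lam -powRrM divfK ?gt_eqF// -powR_mulrn// ltW.
have lammu : lam < mu ^+ 2.
  rewrite -lamp -(mulr_powRB1 _ p0) ?(le_trans ler01 (ltW lam1))//.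
  rewrite ltr_pMr ?(lt_trans ltr01)//.
  have := @gt0_ltr_powR R (p - 1) _ 1 lam.
  by rewrite powR1 !nnegrE subr_gt0; apply => //; exact: le_trans ler01 (ltW lam1).
have muE : mu * (1 - d) = 1 + d by rewrite divfK ?gt_eqF.
pose b2 := ((1 + d) ^+ 2 - lam * (1 - d) ^+ 2) / (lam - 1).
have b20 : 0 < b2.
  apply: divr_gt0; last by rewrite subr_gt0.
  rewrite subr_gt0 -muE exprMn ltr_pM2r// exprn_gt0//.
exists (Num.sqrt b2); first by rewrite sqrtr_gt0.
rewrite sqr_sqrtr ?(ltW b20)//; set X := _ + b2; set Y := (1 - d) ^+ 2 + b2.
have Y0 : 0 < Y by rewrite addr_gt0// exprn_gt0.
have -> : X = lam * Y.
  have : b2 * (lam - 1) = (1 + d) ^+ 2 - lam * (1 - d) ^+ 2.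
    by rewrite divfK// subr_eq0 gt_eqF.
  by rewrite /X /Y; lra.
have lam0 : 0 <= lam by rewrite (le_trans ler01 (ltW lam1)).
rewrite sqrtrM// powRM ?sqrtr_ge0// -[Num.sqrt lam]powR12_sqrt// -[in powR lam _]/lam.
have -> : powR (powR lam 2^-1) p = mu.
  rewrite /lam -!(powRrM mu) (_ : 2 / p / 2 * p = 1) ?powRr1 ?(ltW mu0)//.
  by field; rewrite gt_eqF.
rewrite -muE; field.
by rewrite !gt_eqF// powR_gt0// sqrtr_gt0.
Qed.

Lemma exists_pow2_le (R : realType) (x : R) : 0 < x -> exists m : nat, 2 ^- m <= x.
Proof.
move=> x0; exists (Num.bound x^-1).
have := archi_boundP (ltW (_ : 0 < x^-1)); rewrite invr_gt0 => /(_ x0) xb.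
rewrite -[leRHS]invrK lef_pV2 ?posrE ?exprn_gt0 ?invr_gt0//.
apply: (le_trans (ltW xb)); rewrite -natrX ler_nat; exact/ltnW/ltn_expl.
Qed.

Lemma le_normr_or (R : realType) (x y : R) : y <= x \/ y <= - x -> y <= `|x|.
Proof. by move=> /orP; rewrite ler_normr. Qed.

Lemma subvE (R : realType) (n : nat) (x y : pt R n) k :
  (x - y) ord0 k = x ord0 k - y ord0 k.
Proof. by rewrite mxE [X in _ + X]mxE. Qed.

Section Configuration.
Context {R : realType} {n : nat}.
Variables (i0 i1 : 'I_n) (s d b beta : R).
Hypotheses (i01 : i0 != i1) (s0 : 0 < s) (d0 : 0 < d) (d12 : d <= 2^-1) (b0 : 0 < b).
Hypothesis balanced : (1 + d) / powR (Num.sqrt ((1 + d) ^+ 2 + b ^+ 2)) (s + 1) =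
    (1 - d) / powR (Num.sqrt ((1 - d) ^+ 2 + b ^+ 2)) (s + 1).
Hypothesis betab : b + 1 <= beta.
Implicit Types (e : bool * bool) (j k : 'I_n) (x y z : pt R n).

Local Ltac slra := have ? := d0; have ? := d12; have ? := b0; have ? := betab; lra.

Definition sgn (t : bool) : R := if t then 1 else -1.
Definition dir0 : pt R n := delta_mx ord0 i0.
Definition dir1 : pt R n := delta_mx ord0 i1.
(** The offset [beta] keeps the whole construction in the nonnegative orthant, so that a single
    dyadic cube can contain it. *)
Definition zm : pt R n := const_mx beta.
Definition zp : pt R n := zm + (2 * d) *: dir0.
(* The points (±1, ±b) relative to the midpoint zm + d * dir0 of zm and zp. *)
Definition child_center e : pt R n := zm + (d + sgn e.1) *: dir0 + (sgn e.2 * b) *: dir1.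
(** Centers of children have coordinates at most 2 * beta + 1, and a child has at most half the
    side, by tau <= 1/2; so [Box] contains its four copies. *)
Definition box_side : R := 4 * beta + 4.
Definition Box : set (pt R n) := [set x | forall k, 0 <= x ord0 k <= box_side].

Lemma lincomb_coord (x y : R) k :
  (x *: dir0 + y *: dir1) ord0 k = x * (k == i0)%:R + y * (k == i1)%:R.
Proof. by rewrite !mxE. Qed.

Lemma lincomb_enorm (x y : R) : enorm (x *: dir0 + y *: dir1) = Num.sqrt (x ^+ 2 + y ^+ 2).
Proof.
rewrite /enorm (bigD1 i0)//= (bigD1 i1)/=; last by rewrite eq_sym.
rewrite big1 => [|k /andP[k0 k1]]; last first.
  by rewrite lincomb_coord (negbTE k0) (negbTE k1) !mulr0 addr0 expr0n.
rewrite !lincomb_coord !eqxx (negbTE i01) eq_sym (negbTE i01).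
by rewrite !mulr1 !mulr0 addr0 add0r addr0.
Qed.

(** [c] is [d] at [zm] and [- d] at [zp]. The components along [dir1] cancel between the two signs
    of [e.2], and those along [dir0] by [balanced]. *)
Lemma balanced_sum j (c : R) : c = d \/ c = - d ->
  \sum_e riesz_kernel s j ((c + sgn e.1) *: dir0 + (sgn e.2 * b) *: dir1) = 0.
Proof.
move=> cd; pose P (x : R) := powR (Num.sqrt (x ^+ 2 + b ^+ 2)) (s + 1).
rewrite (eq_bigr (fun e => ((c + sgn e.1) * (j == i0)%:R + sgn e.2 * b * (j == i1)%:R)
   / P (c + sgn e.1))); last first.
  move=> e _; rewrite /riesz_kernel lincomb_coord lincomb_enorm /P exprMn.
  by rewrite (_ : sgn e.2 ^+ 2 = 1) ?mul1r// /sgn; case: e.2; rewrite ?sqrrN expr1n.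
rewrite -(pair_bigA _ (fun a a' => ((c + sgn a) * (j == i0)%:R + sgn a' * b * (j == i1)%:R)
   / P (c + sgn a))) /= !big_bool /= /sgn.
have PN (x : R) : P (- x) = P x by rewrite /P sqrrN.
have bal : (1 + d) / P (1 + d) = (1 - d) / P (1 - d) by exact: balanced.
suff H : (c + 1) / P (c + 1) + (c - 1) / P (c - 1) = 0.
  transitivity (2 * (j == i0)%:R * ((c + 1) / P (c + 1) + (c - 1) / P (c - 1))); last by rewrite H mulr0.
  by ring.
case: cd => ->.
  by rewrite -(opprB 1 d) PN mulNr (addrC d) bal subrr.
by rewrite -opprD PN mulNr (addrC (- d)) (addrC d) bal subrr.
Qed.

Lemma child_center_sub_zm e : child_center e - zm = (d + sgn e.1) *: dir0 + (sgn e.2 * b) *: dir1.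
Proof. by rewrite /child_center -(addrA zm) [LHS]addrC addKr. Qed.

Lemma child_center_sub_zp e : child_center e - zp = (- d + sgn e.1) *: dir0 + (sgn e.2 * b) *: dir1.
Proof.
rewrite /zp opprD addrA child_center_sub_zm addrAC -scalerBl; congr (_ *: _ + _); ring.
Qed.

(** The kernel without truncation, taken at the ideal, unrounded center of the child. *)
Definition child_kernel j z e : R := riesz_kernel s j (child_center e - z).

Lemma kap_sum0 j z : z \in [:: zm; zp] -> \sum_e child_kernel j z e = 0.
Proof.
rewrite !inE => /orP[] /eqP ->; rewrite /child_kernel.
  by under eq_bigr => e _ do rewrite child_center_sub_zm; rewrite balanced_sum//; left.
by under eq_bigr => e _ do rewrite child_center_sub_zp; rewrite balanced_sum//; right.
Qed.

Lemma child_center_i0_far z e : z \in [:: zm; zp] -> (2^-1 : R) <= `|(child_center e - z) ord0 i0|.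
Proof.
rewrite !inE => /orP[] /eqP ->; rewrite ?child_center_sub_zm ?child_center_sub_zp lincomb_coord eqxx (negbTE i01);
  rewrite mulr1 mulr0 addr0 /sgn; case: e.1; apply: le_normr_or; solve [left; slra | right; slra].
Qed.

Lemma Box_z z : z \in [:: zm; zp] -> Box z.
Proof.
rewrite !inE => /orP[] /eqP -> k; rewrite !mxE /box_side; first by slra.
by rewrite eqxx; case: (k == i0); rewrite /= ?mulr1 ?mulr0; slra.
Qed.

Lemma child_center_coord e k : child_center e ord0 k =
  beta + (d + sgn e.1) * (k == i0)%:R + (sgn e.2 * b) * (k == i1)%:R.
Proof. by rewrite !mxE. Qed.

Lemma child_center_range e k : 0 <= child_center e ord0 k <= 2 * beta + 1.
Proof.
rewrite child_center_coord; have [->|k0] := eqVneq k i0.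
  by rewrite (negbTE i01) mulr0 mulr1 addr0 /sgn; case: e.1; slra.
by rewrite mulr0 addr0 /sgn; case: eqVneq => _; case: e.2; rewrite /= ?mulr1 ?mulr0; slra.
Qed.

Variable tau : R.
Hypotheses (tau0 : 0 < tau) (tau12 : tau <= 2^-1) (tau4 : tau * (1 + box_side) <= 4^-1)
  (taub : 2 * (tau * (1 + box_side)) <= b).

Local Ltac tlra := have ? := tau0; have ? := tau12; have ? := tau4; have ? := taub; slra.

(* Rounding to tau * Z^n puts the cubes of all nodes in the standard dyadic grid. *)
Definition rounded_center e : pt R n := \row_k (tau * (Num.floor (child_center e ord0 k / tau))%:~R).
Local Notation phi := (phi_map tau rounded_center).

Lemma rounded_center_coord e k : 0 <= rounded_center e ord0 k /\ rounded_center e ord0 k <= child_center e ord0 k < rounded_center e ord0 k + tau.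
Proof.
rewrite mxE; have /andP[c1 c2] := child_center_range e k.
split; first by rewrite mulr_ge0 ?(ltW tau0)// ler0z floor_ge0 divr_ge0// ltW.
have /andP[f1 f2] := floor_itv (child_center e ord0 k / tau).
rewrite mulrC -ler_pdivlMr// f1 /=.
by move: f2; rewrite ltr_pdivrMr// rmorphD mulrDl /= mul1r.
Qed.

Lemma phiE e x k : phi e x ord0 k = rounded_center e ord0 k + tau * x ord0 k.
Proof. by rewrite /phi_map mxE [X in _ + X]mxE. Qed.

(** Rounding moves the center by less than tau, and the extent of the child adds at most tau *
    box_side. *)
Lemma phi_coord e x k : Box x -> `|phi e x ord0 k - child_center e ord0 k| < tau * (1 + box_side).
Proof.
move=> /(_ k) /andP[x0 xL]; have [_ /andP[c1 c2]] := rounded_center_coord e k.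
rewrite phiE.
have := ler_wpM2l (ltW tau0) xL; have := mulr_ge0 (ltW tau0) x0.
have : 0 < tau * box_side by rewrite mulr_gt0// /box_side; tlra.
by rewrite ltr_norml => ? ? ?; apply/andP; split; tlra.
Qed.

Lemma Box_phi e x : Box x -> Box (phi e x).
Proof.
move=> Bx k; have /andP[x0 xL] := Bx k; have [cs0 /andP[c1 c2]] := rounded_center_coord e k.
have /andP[_ cL] := child_center_range e k.
rewrite phiE.
have := ler_wpM2l (ltW tau0) xL; have := mulr_ge0 (ltW tau0) x0.
have : tau * box_side <= 2^-1 * box_side by rewrite ler_wpM2r// /box_side; tlra.
by rewrite {2 4}/box_side => ? ? ?; apply/andP; split; tlra.
Qed.

Lemma top_far e x z : z \in [:: zm; zp] -> Box x -> 4^-1 <= enorm (phi e x - z).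
Proof.
move=> zz Bx; apply: le_trans (coord_le_enorm _ i0).
have far := child_center_i0_far e zz; have close := phi_coord e i0 Bx.
have -> : (phi e x - z) ord0 i0 = (child_center e - z) ord0 i0 +
    (phi e x ord0 i0 - child_center e ord0 i0).
  by rewrite !subvE; ring.
have := lerB_normD ((child_center e - z) ord0 i0) (phi e x ord0 i0 - child_center e ord0 i0).
by move=> /(le_trans _); apply; tlra.
Qed.

Lemma top_near e x z : z \in [:: zm; zp] -> Box x -> enorm (phi e x - z) <= n%:R * box_side.
Proof.
move=> /Box_z Bz /(Box_phi e) Bp; apply: enorm_le => k; rewrite subvE.
have /andP[? ?] := Bp k; have /andP[? ?] := Bz k.
by rewrite ler_norml; apply/andP; split; tlra.
Qed.

(** Centers of different children differ by 2 along [i0] or by 2 * b along [i1], and each of the two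
    points is displaced by at most 1/4, by [tau4], and at most b / 2, by [taub]. *)
Lemma cross_far e e' x y : e != e' -> Box x -> Box y ->
  Num.min 4^-1 b <= enorm (phi e x - phi e' y).
Proof.
move=> ee' Bx By.
suff [k Hk] : exists k, Num.min 4^-1 b <= `|phi e x ord0 k - phi e' y ord0 k|.
  by apply: le_trans (coord_le_enorm _ k); rewrite subvE.
have : e.1 != e'.1 \/ e.2 != e'.2.
  apply/orP; apply: contraNT ee'; rewrite negb_or !negbK => /andP[/eqP h1 /eqP h2].
  by rewrite (surjective_pairing e) (surjective_pairing e') h1 h2.
case=> ne.
  exists i0; apply: (@le_trans _ _ 4^-1); first by rewrite ge_min lexx.
  have := phi_coord e i0 Bx; have := phi_coord e' i0 By.
  rewrite !ltr_norml !child_center_coord eqxx (negbTE i01) !mulr1 !mulr0 /sgn.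
  move: ne; case: e.1; case: e'.1 => //= _ /andP[? ?] /andP[? ?]; apply: le_normr_or; [left|right]; tlra.
exists i1; apply: (@le_trans _ _ b); first by rewrite ge_min lexx orbT.
have := phi_coord e i1 Bx; have := phi_coord e' i1 By.
rewrite !ltr_norml !child_center_coord eqxx [i1 == i0]eq_sym (negbTE i01) !mulr1 !mulr0 /sgn.
move: ne; case: e.2; case: e'.2 => //= _ /andP[? ?] /andP[? ?]; apply: le_normr_or; [left|right]; tlra.
Qed.

End Configuration.

(** * Uniform bound for the truncated Riesz transforms *)

Lemma bernoulli_inv (R : realType) (th : R) (N : nat) : 0 <= th -> 2 * N%:R * th <= 1 ->
  (1 + th) ^+ N <= 2.
Proof.
move=> th0 Nth.
(* The bound (1 + th)^k <= 1 / (1 - k * th), written without division; at k = N the second factor is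
   at least 1/2. *)
have H k : (1 + th) ^+ k * (1 - k%:R * th) <= 1.
  elim: k => [|k IH]; first by rewrite expr0 mul0r subr0 mul1r.
  apply: le_trans IH; rewrite exprS mulrAC mulrC ler_wpM2l ?exprn_ge0 ?addr_ge0//.
  have : 0 <= k%:R * (th * th) by rewrite !mulr_ge0.
  have : 0 <= th * th by rewrite mulr_ge0.
  by rewrite -natr1; lra.
have := H N; have : 0 <= (1 + th) ^+ N by rewrite exprn_ge0 ?addr_ge0.
by nra.
Qed.

Lemma dint_setT (R : realType) n (mu : dmeas R n) f : dint mu setT f = wsum mu f.
Proof. by apply: eq_bigr => q _; rewrite asboolT// mulrC. Qed.

Lemma riesz_truncE (R : realType) n (alpha : R) (sigma : dmeas R n) delta R0 f x j :
  riesz_trunc alpha sigma delta R0 f x ord0 j =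
  wsum sigma (fun y => trunc_kernel (n%:R - alpha) j delta R0 (x - y) * f y).
Proof.
rewrite /riesz_trunc /wsum summxE; apply: eq_bigr => q _.
rewrite mxE /trunc_kernel /riesz_kernel (_ : n%:R - alpha + 1 = n%:R + 1 - alpha); last by ring.
ring.
Qed.

Section Bound.
Context {R : realType} {n : nat}.
Variables (i0 i1 : 'I_n) (alpha d b beta : R).
Let s : R := n%:R - alpha.
Hypotheses (i01 : i0 != i1) (s0 : 0 < s) (d0 : 0 < d) (d12 : d <= 2^-1) (b0 : 0 < b).
Hypothesis balanced : (1 + d) / powR (Num.sqrt ((1 + d) ^+ 2 + b ^+ 2)) (s + 1) =
    (1 - d) / powR (Num.sqrt ((1 - d) ^+ 2 + b ^+ 2)) (s + 1).
Hypothesis betab : b + 1 <= beta.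

Let kappa : R := Num.min 4^-1 b.
Let C0 : R := (powR kappa s)^-1.
Local Notation L := (box_side beta).
Local Notation zm := (@zm R n beta).
Local Notation zp := (@zp R n i0 d beta).
Local Notation rounded_center := (rounded_center i0 i1 d b beta).

(** With th = 1 / (2 * N) the N losses multiply to at most 2, and tau is taken so small, depending
    on N, that the N errors add up to at most 1. The constant collects 4 * C0 ^+ 2 from the
    variance, 4 * C0 ^+ 2 from the two radii and 1 from the errors. *)
Lemma adjoint_bound_tau (N : nat) : (0 < N)%N ->
  exists2 tau0 : R, 0 < tau0 & forall tau : R, 0 < tau -> tau <= tau0 ->
  [/\ tau <= 2^-1, tau * (1 + L) <= 4^-1, 2 * (tau * (1 + L)) <= b &
    forall (j : 'I_n) (delta R0 : R) (g : pt R n -> R),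
    wsum (sigmaN tau (powR tau s) (rounded_center tau) zm zp N) (fun y =>
      wsum (omegaN tau (rounded_center tau) N) (fun x => trunc_kernel s j delta R0 (x - y) * g x) ^+ 2)
    <= 2 * (8 * C0 ^+ 2 + 1) * wsum (omegaN tau (rounded_center tau) N) (fun x => g x ^+ 2)].
Proof.
move=> N0; have NR0 : 0 < N%:R :> R by rewrite ltr0n.
have NR1 : 1 <= N%:R :> R by rewrite ler1n.
have n0 : 0 < n%:R :> R by rewrite ltr0n; case: (n) i0 => // -[].
have kappa0 : 0 < kappa by rewrite lt_min invr_gt0 ltr0n b0.
have C00 : 0 <= C0 by rewrite invr_ge0 powR_ge0.
have L0 : 0 < L by have ? := betab; have ? := b0; rewrite /box_side; lra.
(* Chosen so that N * (4 * e1 ^+ 2) = e1 <= 1/2. *)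
pose e1 : R := (4 * N%:R)^-1.
have e10 : 0 < e1 by rewrite invr_gt0 mulr_gt0.
(* The eight vectors from a sigma-point of the root to the center of a child. *)
pose w (t : bool * bool * bool) := child_center i0 i1 d b beta t.1 - (if t.2 then zm else zp).
have [|rho rho0 rhoP] := @riesz_kernel_unif R n s _ w e1 e10.
  move=> [e t]; apply: (@enorm_gt0 _ _ _ i0); rewrite -normr_gt0.
  apply: lt_le_trans (@child_center_i0_far R n i0 i1 d b beta i01 d0 d12 b0 betab _ e _).
    by rewrite invr_gt0.
  by rewrite !inE; case: t; rewrite eqxx ?orbT.
(* A bound for tau^s under which the interactions between different children, weighted by 1 + th^-1
   = 1 + 2 * N and summed over N generations, contribute at most 1/2. *)
pose c : R := (96 * (N%:R * (1 + 2 * N%:R)) * (C0 ^+ 2 + 1))^-1.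
have C20 : 0 <= C0 ^+ 2 by rewrite sqr_ge0.
have NN : 1 <= N%:R * (1 + 2 * N%:R) :> R by nra.
have c0 : 0 < c.
  have C21 : 0 < C0 ^+ 2 + 1 by lra.
  by rewrite invr_gt0 mulr_gt0// mulr_gt0// (lt_le_trans ltr01 NN).
have cE : c * (96 * (N%:R * (1 + 2 * N%:R)) * (C0 ^+ 2 + 1)) = 1.
  by rewrite mulVf// gt_eqF// -invr_gt0.
have c48 : 48 * c <= 2^-1.
  have : 0 <= c * ((N%:R * (1 + 2 * N%:R)) * (C0 ^+ 2 + 1) - 1).
    by rewrite mulr_ge0 ?(ltW c0)// subr_ge0 -[leLHS]mul1r ler_pM// lerDr.
  by lra.
have cC : 48 * c * (N%:R * (1 + 2 * N%:R)) * C0 ^+ 2 <= 2^-1.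
  have : 0 <= c * (N%:R * (1 + 2 * N%:R)) by rewrite mulr_ge0 ?(ltW c0)// (le_trans ler01 NN).
  by lra.
(* In this order: tau <= 1/2, [tau4], [taub], children within [rho] of their centers, tau * k2 < k1
   for [ncut_le1] with k1 = 1/4 and k2 = n * L, and tau^s <= c. *)
pose tau0 : R := Num.min (Num.min (Num.min 2^-1 (4^-1 / (1 + L))) (Num.min (b / 2 / (1 + L)) (rho / (1 + L))))
  (Num.min (8^-1 / (n%:R * L)) (powR c s^-1)).
have L10 : 0 < 1 + L by rewrite addr_gt0.
exists tau0.
  have inv4 : 0 < 4^-1 :> R by rewrite invr_gt0.
  have inv8 : 0 < 8^-1 :> R by rewrite invr_gt0.
  have b2 : 0 < b / 2 by rewrite divr_gt0.
  rewrite !lt_min (divr_gt0 inv4 L10) (divr_gt0 b2 L10) (divr_gt0 rho0 L10).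
  by rewrite (divr_gt0 inv8 (mulr_gt0 n0 L0)) powR_gt0// invr_gt0 ltr0n.
move=> tau t0; rewrite !le_min => /andP[/andP[/andP[t1 t2] /andP[t3 t4]] /andP[t5 t6]].
have {}t2 : tau * (1 + L) <= 4^-1 by rewrite -ler_pdivlMr.
have {}t3 : 2 * (tau * (1 + L)) <= b by move: t3; rewrite ler_pdivlMr// => ?; lra.
have {}t4 : tau * (1 + L) <= rho by rewrite -ler_pdivlMr.
have {}t5 : tau * (n%:R * L) < 4^-1.
  by move: t5; rewrite ler_pdivlMr ?mulr_gt0// => ?; lra.
split=> // j delta R0 g; set ts := powR tau s.
have ts0 : 0 < ts by rewrite powR_gt0.
have tsc : ts <= c.
  have <- : powR (powR c s^-1) s = c.
    by rewrite -powRrM mulVf ?gt_eqF// powRr1// ltW.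
  by rewrite ge0_ler_powR ?nnegrE ?powR_ge0 ?(ltW s0) ?(ltW t0).
have ts2c : ts ^+ 2 <= c by rewrite expr2; nra.
have th0 : 0 < (2 * N%:R)^-1 :> R by rewrite invr_gt0 mulr_gt0.
have tcs0 := t0.
have Bz := @Box_z R n i0 d b beta d0 d12 b0 betab.
have B0 : Box beta (0 : pt R n) by move=> k; rewrite mxE lexx ltW.
have kap4 : kappa <= 4^-1 by rewrite ge_min lexx.
have Bphi := @Box_phi R n i0 i1 d b beta i01 d0 d12 b0 betab tau t0 t1 t2 t3.
have top := @top_far R n i0 i1 d b beta i01 d0 d12 b0 betab tau t0 t1 t2 t3.
have topn := @top_near R n i0 i1 d b beta i01 d0 d12 b0 betab tau t0 t1 t2 t3.
have cross := @cross_far R n i0 i1 d b beta i01 d0 d12 b0 betab tau t0 t1 t2 t3.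
have phic := @phi_coord R n i0 i1 d b beta i01 d0 d12 b0 betab tau t0 t1 t2 t3.
have ts1 : 48 * ts ^+ 2 <= 1 by lra.
have Ksc (D S : R) v : trunc_kernel s j D S (tau *: v) = ts^-1 * trunc_kernel s j (D / tau) (S / tau) v.
  exact: trunc_kernel_scale.
have Kcr (D S : R) e e' x y : e != e' -> Box beta x -> Box beta y ->
    `|trunc_kernel s j D S (phi_map tau (rounded_center tau) e x - phi_map tau (rounded_center tau) e' y)| <= C0.
  by move=> *; apply: trunc_kernel_le => //; exact: cross.
have Ktop (D S : R) e x z : z \in [:: zm; zp] -> Box beta x ->
    `|trunc_kernel s j D S (phi_map tau (rounded_center tau) e x - z)| <= C0.
  by move=> *; apply: trunc_kernel_le => //; apply: le_trans kap4 _; exact: top.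
have kap0 : forall z, z \in [:: zm; zp] -> \sum_e child_kernel i0 i1 s d b beta j z e = 0.
  by move=> z zz; exact: kap_sum0.
have kaple z e : z \in [:: zm; zp] -> `|child_kernel i0 i1 s d b beta j z e| <= C0.
  move=> zz; apply: riesz_kernel_le => //; apply: le_trans (coord_le_enorm _ i0).
  by apply: le_trans (@child_center_i0_far R n i0 i1 d b beta i01 d0 d12 b0 betab _ e zz); lra.
have Kin (D S : R) e x z : z \in [:: zm; zp] -> Box beta x -> D < 4^-1 -> n%:R * L < S ->
    `|trunc_kernel s j D S (phi_map tau (rounded_center tau) e x - z) - child_kernel i0 i1 s d b beta j z e| <= e1.
  move=> zz Bx D4 LS; rewrite /trunc_kernel /Defs.eta.
  rewrite (le_trans (ltW D4) (top e x z zz Bx)) (le_trans (topn e x z zz Bx) (ltW LS)) mul1r.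
  rewrite /child_kernel; have [t zt] : exists t : bool, z = if t then zm else zp.
    by move: zz; rewrite !inE => /orP[/eqP ->|/eqP ->]; [exists true|exists false].
  have := rhoP (e, t) j (phi_map tau (rounded_center tau) e x - z); rewrite /w /= -zt; apply => k.
  rewrite !subvE opprB addrA subrK.
  by apply: lt_le_trans (phic e x k Bx) t4.
have Kout (D S : R) e x z : z \in [:: zm; zp] -> Box beta x ->
    n%:R * L < D \/ S < 4^-1 -> trunc_kernel s j D S (phi_map tau (rounded_center tau) e x - z) = 0.
  move=> zz Bx out; rewrite /trunc_kernel /Defs.eta; case: ifP => [/andP[h1 h2]|_]; last by rewrite mul0r.
  exfalso; case: out => [LD|S4].
    by have := le_lt_trans (le_trans h1 (topn e x z zz Bx)) LD; rewrite ltxx.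
  by have := le_lt_trans (le_trans (top e x z zz Bx) h2) S4; rewrite ltxx.
have := @adjoint_induction R n tau ts (rounded_center tau) zm zp (trunc_kernel s j) (child_kernel i0 i1 s d b beta j)
  C0 e1 4^-1 (n%:R * L) (Box beta) ts0 ts1 C00 B0 Bz Bphi Ksc Kcr Ktop kap0 kaple Kin Kout
  N delta R0 g _ th0.
set th := (2 * N%:R)^-1 in th0 *; set A := wsum _ _; set G := wsum _ (fun x => g x ^+ 2).
set m := wsum _ _ ^+ 2; set n1 := ncut _ _ _ _ _; set n2 := ncut _ _ _ _ _.
have t01 : tau < 1 by lra.
have nL0 : 0 <= n%:R * L by rewrite mulr_ge0 ?(ltW n0) ?(ltW L0).
have n11 : n1 <= 1 by exact: ncut_le1.
have n21 : n2 <= 1 by exact: ncut_le1.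
have m0 : 0 <= m by exact: sqr_ge0.
have G0 : 0 <= G by exact: nrm_ge0.
have thN : 2 * N%:R * th = 1 by rewrite mulfV// gt_eqF// mulr_gt0.
have P2 : (1 + th) ^+ N <= 2 by apply: bernoulli_inv; rewrite ?(ltW th0) ?thN.
have thV : th^-1 = 2 * N%:R by rewrite invrK.
have e1N : N%:R * (4 * e1 ^+ 2) <= 2^-1.
  have e1E : e1 * (4 * N%:R) = 1 by rewrite mulVf// gt_eqF// mulr_gt0.
  have : N%:R * (4 * e1 ^+ 2) = e1 by transitivity (e1 * (e1 * (4 * N%:R))); [ring|rewrite e1E mulr1].
  move=> ->; nra.
have errN : N%:R * ((1 + th^-1) * (48 * ts ^+ 2 * C0 ^+ 2)) <= 2^-1.
  apply: le_trans cC; rewrite thV.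
  have -> : N%:R * ((1 + 2 * N%:R) * (48 * ts ^+ 2 * C0 ^+ 2)) =
    48 * (ts ^+ 2 * (N%:R * (1 + 2 * N%:R) * C0 ^+ 2)) by ring.
  have Q0 : 0 <= N%:R * (1 + 2 * N%:R) * C0 ^+ 2.
    by rewrite mulr_ge0// (le_trans ler01 NN).
  have := ler_wpM2r Q0 ts2c; lra.
set err := N%:R * (_ + _); have err1 : err <= 1 by rewrite /err mulrDr; lra.
have Y0 : 0 <= (8 * C0 ^+ 2 + 1) * G by rewrite mulr_ge0// addr_ge0// mulr_ge0.
move=> /le_trans; apply; rewrite -[leRHS]mulrA.
apply: (@le_trans _ _ ((1 + th) ^+ N * ((8 * C0 ^+ 2 + 1) * G))); last exact: ler_wpM2r.
rewrite ler_wpM2l ?exprn_ge0 ?addr_ge0 ?(ltW th0)//.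
have := mulr_ge0 C20 m0.
have : 0 <= C0 ^+ 2 * G * (2 - n1 - n2) by rewrite !mulr_ge0//; lra.
have : 0 <= G * (1 - err) by rewrite mulr_ge0// subr_ge0.
by lra.
Qed.

(** Each of the n components is a scalar operator to which [adjoint_bound] applies, whence the
    factor n. The constant depends on neither N nor tau. *)
Lemma riesz_bound_tau (N : nat) : (0 < N)%N ->
  exists2 tau0 : R, 0 < tau0 & forall tau : R, 0 < tau -> tau <= tau0 ->
  [/\ tau <= 2^-1, tau * (1 + L) <= 4^-1, 2 * (tau * (1 + L)) <= b &
    forall (f : pt R n -> R) (delta R0 : R),
    L2norm_vec (omegaN tau (rounded_center tau) N)
      (riesz_trunc alpha (sigmaN tau (powR tau s) (rounded_center tau) zm zp N) delta R0 f)
    <= Num.sqrt (n%:R * (2 * (8 * C0 ^+ 2 + 1))) *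
       L2norm (sigmaN tau (powR tau s) (rounded_center tau) zm zp N) f].
Proof.
move=> N0; have [tau0 tau00 H] := adjoint_bound_tau N0.
exists tau0 => // tau t0 tt0; have [h1 h2 h3 adj] := H _ t0 tt0; split=> // f delta R0.
set sigma := sigmaN _ _ _ _ _ _; set omega := omegaN _ _ _.
set C := 2 * (8 * C0 ^+ 2 + 1).
have C0' : 0 < C by rewrite mulr_gt0// ltr_wpDl// mulr_ge0// sqr_ge0.
rewrite /L2norm_vec /L2norm !dint_setT -sqrtrM; last by rewrite mulr_ge0// ltW.
apply: ler_wsqrtr.
rewrite (@eq_wsum _ _ _ _ (fun x => \sum_j
   wsum sigma (fun y => trunc_kernel s j delta R0 (x - y) * f y) ^+ 2)); last first.
  by move=> q _; rewrite sqr_enorm; apply: eq_bigr => j _; rewrite riesz_truncE.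
rewrite wsum_sum -mulrA.
have bound j : wsum omega (fun x => wsum sigma (fun y => trunc_kernel s j delta R0 (x - y) * f y) ^+ 2)
   <= C * wsum sigma (fun y => f y ^+ 2).
  apply: (@adjoint_bound _ _ sigma omega (fun x y => trunc_kernel s j delta R0 (x - y))) => //.
  by apply: sigmaN_pos; exact: powR_gt0.
apply: le_trans; first by apply: ler_sum => j _; exact: bound.
by rewrite sumr_const card_ord -[leLHS]mulr_natl.
Qed.

End Bound.

(** * Dyadic cubes *)

Section Dyadic.
Context {R : realType} {n : nat}.
Implicit Types (P Q J K M : cube R n).

Definition grid0 : int -> pt R n := fun=> 0.

Lemma grid0_ok : grid_ok grid0.
Proof. by move=> k i; exists 0; rewrite !mxE subrr mulr0. Qed.

Lemma in_grid0 Q : in_grid grid0 Q <-> exists (k : int) (m : 'I_n -> int),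
  Q.2 = (2 : R) ^ k /\ forall i, Q.1 ord0 i = (2 : R) ^ k * (m i)%:~R.
Proof.
by split=> -[k [m [Qk Qm]]]; exists k, m; split=> // i; rewrite Qm mxE addr0.
Qed.

Lemma in_grid_side_gt0 Q : in_grid grid0 Q -> 0 < Q.2.
Proof. by case=> k [m [-> _]]; exact: exprz_gt0. Qed.

Lemma corner_in Q : 0 < Q.2 -> cube_set Q Q.1.
Proof. by move=> Q0 i; rewrite lexx ltrDl. Qed.

Lemma shift_in Q (t : R) : 0 <= t -> t < Q.2 -> cube_set Q (Q.1 + t *: const_mx 1).
Proof. by move=> t0 tQ i; rewrite !mxE mulr1 lerDl t0 ltrD2l. Qed.

Lemma center_in Q : 0 < Q.2 -> cube_set Q (Defs.center Q).
Proof. by move=> Q0; apply: shift_in; rewrite ?divr_ge0 ?(ltW Q0)//; lra. Qed.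

(** If [M] were longer than [J], the corner of [M] moved along the diagonal by the side of [J] would
    stay in [M] and leave [J]. *)
Lemma subset_side M J : (0 < n)%N -> 0 < M.2 -> cube_set M `<=` cube_set J -> M.2 <= J.2.
Proof.
move=> n0 M0 MJ; pose i := Ordinal n0.
have /andP[J1 J2] := MJ _ (corner_in M0) i.
rewrite leNgt; apply/negP => JM.
have := MJ _ (@shift_in M J.2 _ JM); have -> : 0 <= J.2 by lra.
by move=> /(_ isT i) /andP[_]; rewrite !mxE mulr1 ltrD2r ltNge J1.
Qed.

Lemma subset_same_side M J : 0 < M.2 -> M.2 = J.2 ->
  cube_set M `<=` cube_set J -> cube_set J = cube_set M.
Proof.
move=> M0 MJ2 MJ; suff E : forall i, J.1 ord0 i = M.1 ord0 i.
  by apply/seteqP; split=> x Jx i; have := Jx i; rewrite MJ2 E.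
move=> i; apply/eqP; rewrite eq_le.
have /andP[J1 J2] := MJ _ (corner_in M0) i.
rewrite J1 /= leNgt; apply/negP => JM.
have := MJ _ (@shift_in M (J.2 - (M.1 ord0 i - J.1 ord0 i)) _ _).
have -> : 0 <= J.2 - (M.1 ord0 i - J.1 ord0 i) by lra.
have -> : J.2 - (M.1 ord0 i - J.1 ord0 i) < M.2 by lra.
by move=> /(_ isT isT i) /andP[_]; rewrite !mxE mulr1; lra.
Qed.

Lemma exprz2_le (a c : int) : ((2 : R) ^ a <= 2 ^ c) = (a <= c).
Proof. by rewrite ler_eXz2l// ltr1n. Qed.

Lemma grid_ratio J J' : in_grid grid0 J -> in_grid grid0 J' -> J.2 <= J'.2 ->
  exists j : nat, J'.2 = 2 ^+ j * J.2.
Proof.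
move=> [k [_ [-> _]]] [k' [_ [-> _]]]; rewrite exprz2_le => kk'.
exists `|k' - k|%N; rewrite exprnP gez0_abs ?subr_ge0//.
by rewrite -expfzDr ?subrK// pnatr_eq0.
Qed.

(** Deeply embedded grid cubes containing [J] have side 2^j times that of [J] and at most 2^-r times
    that of [K], so one with largest [j] exists, and it is maximal for inclusion. *)
Lemma exists_Mdeep r (eps : R) J K : (0 < n)%N -> in_grid grid0 J ->
  deep_emb r eps J K -> exists2 M, Mdeep grid0 r eps K M & cube_set J `<=` cube_set M.
Proof.
move=> n0 Jg Jd; have J0 := in_grid_side_gt0 Jg.
pose P (j : nat) := `[< exists M, [/\ in_grid grid0 M, deep_emb r eps M K,
   cube_set J `<=` cube_set M & M.2 = 2 ^+ j * J.2] >].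
have exP : exists j, P j.
  by exists 0%N; apply/asboolP; exists J; rewrite expr0 mul1r; split.
pose X := 2 ^- r * K.2 / J.2.
have bdP j : P j -> (j <= Num.bound X)%N.
  move=> /asboolP[M [_ [_ [MK _]] _ MJ]].
  have jX : 2 ^+ j <= X by rewrite ler_pdivlMr// -MJ.
  have X0 : 0 <= X by apply: le_trans jX; rewrite exprn_ge0.
  have : j%:R < (Num.bound X)%:R :> R.
    apply: le_lt_trans (archi_boundP X0); apply: le_trans jX.
    by rewrite -natrX ler_nat; exact/ltnW/ltn_expl.
  by rewrite ltr_nat => /ltnW.
case: (ex_maxnP exP bdP) => j /asboolP[M [Mg Md JM Mj]] jmax.
exists M => //; split=> //; split=> // J' J'g J'd MJ'.
have M0 := in_grid_side_gt0 Mg.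
have MJ'2 := subset_side n0 M0 MJ'.
have [j' J'j] := grid_ratio Jg J'g (subset_side n0 J0 (subset_trans JM MJ')).
apply: subset_same_side => //; apply/eqP; rewrite eq_le MJ'2 /= J'j Mj.
rewrite ler_pM2r// ler_eXn2l ?ltr1n//; apply: jmax; apply/asboolP.
by exists J'; split=> //; exact: subset_trans MJ'.
Qed.

Lemma interior_cube Q (y : pt R n) :
  (forall i, Q.1 ord0 i < y ord0 i < Q.1 ord0 i + Q.2) -> interior (cube_set Q) y.
Proof.
move=> yQ; rewrite /interior /=.
apply: (@filter_forall (pt R n) _ (fun i (z : pt R n) =>
    is_true (Q.1 ord0 i <= z ord0 i < Q.1 ord0 i + Q.2)) (nbhs y)) => i.
  have /andP[y1 y2] := yQ i.
  have co := @coord_continuous R 1 n ord0 i y.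
  apply: (co [set t : R | Q.1 ord0 i <= t < Q.1 ord0 i + Q.2]).
  near=> t; apply/andP; split; first by apply/ltW; near: t; exact: lt_nbhsr.
  by near: t; exact: lt_nbhsl.
Unshelve. all: by end_near. Qed.

(** Makes the set of distances to the boundary nonempty, without which a lower bound does not pass
    to [inf]. *)
Lemma corner_bdry Q : (0 < n)%N -> 0 < Q.2 -> bdry (cube_set Q) Q.1.
Proof.
move=> n0 Q0; split; first exact/subset_closure/corner_in.
rewrite /interior => /nbhs_ballP[e /= e0 He].
have Hin : ball Q.1 e (Q.1 - (e / 2) *: const_mx 1).
  split=> // i j; rewrite /ball /= !mxE mulr1 ord1 opprD opprK addrA subrr add0r.
  by rewrite gtr0_norm; lra.
by have /andP[+ _] := He _ Hin (Ordinal n0); rewrite !mxE mulr1; lra.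
Qed.

(** The lower corner of this cube is the center of [K], so its distance to the boundary is at least
    (1/2 - 2^-q) * K.2, whereas deep embedding asks for 1/2 * (2^-q)^eps * K.2. *)
Lemma deep_emb_center r (eps : R) K (q : nat) : (0 < n)%N -> 0 < K.2 -> (r <= q)%N ->
  2^-1 * powR (2 ^- q) eps <= 2^-1 - 2 ^- q ->
  deep_emb r eps (K.1 + (K.2 / 2) *: const_mx 1, 2 ^- q * K.2) K.
Proof.
(* In this proof [riesz_kernel] is the hypothesis 0 < K.2. *)
move=> n0 riesz_kernel rq Hq; set J := (_, _).
have qinv0 : 0 < 2 ^- q :> R by rewrite invr_gt0 exprn_gt0.
have qhalf : 2 ^- q <= 2^-1 :> R.
  by have := powR_ge0 (2 ^- q : R) eps; lra.
have JK x i : cube_set J x -> K.1 ord0 i + K.2 / 2 <= x ord0 i < K.1 ord0 i + K.2 / 2 + 2 ^- q * K.2.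
  by move=> /(_ i); rewrite !mxE mulr1.
have qK : 2 ^- q * K.2 <= 2^-1 * K.2 by rewrite ler_wpM2r// ltW.
split; [|split].
- by move=> x Jx i; have /andP[? ?] := JK _ i Jx; apply/andP; split; lra.
- rewrite /side ler_wpM2r ?(ltW riesz_kernel)// lef_pV2 ?posrE ?exprn_gt0//.
  by rewrite ler_eXn2l ?ltr1n.
rewrite /dist_set; apply: lb_le_inf.
  exists (enorm (J.1 - K.1)); exists J.1; first by apply: corner_in; rewrite mulr_gt0.
  by exists K.1 => //; exact: corner_bdry.
move=> _ [x Jx] [y [_ yK]] <-.
have -> : 2^-1 * powR (side J) eps * powR (side K) (1 - eps) =
    2^-1 * powR (2 ^- q) eps * K.2.
  rewrite /side powRM ?(ltW riesz_kernel) ?(ltW qinv0)//.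
  have KE : powR K.2 eps * powR K.2 (1 - eps) = K.2.
    by rewrite -powRD ?subrKC ?powRr1 ?oner_eq0 ?(ltW riesz_kernel).
  by rewrite -[X in _ = _ * X]KE; ring.
apply: (@le_trans _ _ ((2^-1 - 2 ^- q) * K.2)); first by rewrite ler_wpM2r// ltW.
have [i Hi] : exists i, ~ (K.1 ord0 i < y ord0 i < K.1 ord0 i + K.2).
  by apply/existsNP => H; apply: yK; exact: interior_cube.
apply: le_trans (coord_le_enorm _ i); rewrite subvE.
have /andP[x1 x2] := JK _ i Jx.
have [yl|yl] := leP (y ord0 i) (K.1 ord0 i); apply: le_normr_or; [left|right]; first by lra.
have : K.1 ord0 i + K.2 <= y ord0 i by rewrite leNgt; apply/negP => h; apply: Hi; rewrite yl h.
by lra.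
Qed.

(** In units of the side of [J], both corners and the side of [K] are integers; a common point gives
    strict inequalities between integers, which gain 1. *)
Lemma grid_nested J K (x : pt R n) : in_grid grid0 J -> in_grid grid0 K -> J.2 <= K.2 ->
  cube_set J x -> cube_set K x -> cube_set J `<=` cube_set K.
Proof.
move=> Jg Kg JK Jx Kx; have J0 := in_grid_side_gt0 Jg.
have [j Kj] := grid_ratio Jg Kg JK.
move: Jg Kg => /in_grid0[k [m [Jk Jm]]] /in_grid0[k' [m' [Kk Km]]].
have {}Km i : K.1 ord0 i = J.2 * (2 ^+ j * m' i)%:~R.
  by rewrite Km -Kk Kj rmorphM rmorphXn /=; ring.
have {}Jm i : J.1 ord0 i = J.2 * (m i)%:~R by rewrite Jm Jk.
have KE : K.2 = J.2 * (2 ^+ j)%:~R by rewrite Kj rmorphXn mulrC.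
move=> y Jy i; have /andP[x1 x2] := Jx i; have /andP[x3 x4] := Kx i.
have /andP[y1 y2] := Jy i.
have l1 : 2 ^+ j * m' i <= m i.
  rewrite -ltzD1 -(ltr_int R) rmorphD /= -(ltr_pM2l J0) mulrDr mulr1 -Km -Jm.
  exact: le_lt_trans x2.
have l2 : m i + 1 <= 2 ^+ j * m' i + 2 ^+ j.
  rewrite lezD1 -(ltr_int R) rmorphD /= -(ltr_pM2l J0) mulrDr -Km -Jm -KE.
  exact: le_lt_trans x4.
apply/andP; split.
  by apply: le_trans y1; rewrite Km Jm ler_pM2l// ler_int.
apply: (lt_le_trans y2); rewrite Km Jm KE -{2}[J.2]mulr1 -!mulrDr ler_pM2l//.
by rewrite -[1]/(1%:~R) -!rmorphD ler_int.
Qed.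

Lemma exists_grid_cube (k : int) (x : pt R n) :
  exists Q, [/\ in_grid grid0 Q, Q.2 = (2 : R) ^ k & cube_set Q x].
Proof.
pose z i := Num.floor (x ord0 i / (2 : R) ^ k).
have k0 : 0 < (2 : R) ^ k by exact: exprz_gt0.
exists (\row_i ((2 : R) ^ k * (z i)%:~R), (2 : R) ^ k); split=> //.
  by apply/in_grid0; exists k, z; split=> // i; rewrite mxE.
move=> i; rewrite !mxE /=; have /andP[f1 f2] := floor_itv (x ord0 i / (2 : R) ^ k).
rewrite mulrC -ler_pdivlMr// f1 /=.
by move: f2; rewrite ltr_pdivrMr// rmorphD mulrDl /= mul1r.
Qed.

End Dyadic.

(** * The tree of nodes *)

Lemma in_grid_lattice (R : realType) n (Q : cube R n) (e : nat) : Q.2 = 2 ^- e ->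
  (forall i, exists z : int, Q.1 ord0 i = Q.2 * z%:~R) -> in_grid (@grid0 R n) Q.
Proof.
move=> Qe /choice[m Hm]; apply/in_grid0; exists (- e%:Z), m.
by rewrite -exprnN -Qe.
Qed.

Section Nodes.
Context {R : realType} {n : nat}.
Variables (i0 i1 : 'I_n) (s d b beta tau h : R) (m a B : nat).
Hypotheses (i01 : i0 != i1) (s0 : 0 < s) (d0 : 0 < d) (d12 : d <= 2^-1) (b0 : 0 < b).
Hypothesis betab : b + 1 <= beta.
Hypotheses (tau0 : 0 < tau) (tau12 : tau <= 2^-1).
Hypotheses (tau4 : tau * (1 + box_side beta) <= 4^-1) (taub : 2 * (tau * (1 + box_side beta)) <= b).
Hypotheses (tauE : tau = 2 ^- m) (hE : h = 2 ^- a) (betaE : beta = B%:R + h / 2).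
Hypotheses (h2 : h <= 2^-1) (dh : 4 * d <= h).

Local Notation L := (box_side beta).
Local Notation zm := (@zm R n beta).
Local Notation zp := (@zp R n i0 d beta).
Local Notation rounded_center := (rounded_center i0 i1 d b beta tau).
Local Notation phi := (phi_map tau rounded_center).
Local Notation omegaN := (omegaN tau rounded_center).
Local Notation sigmaN := (sigmaN tau (powR tau s) rounded_center zm zp).
Local Notation node := (pt R n * R * R)%type.
Implicit Types (q : node) (x y : pt R n) (e : bool * bool).

Let phic := @phi_coord R n i0 i1 d b beta i01 d0 d12 b0 betab tau tau0 tau12 tau4 taub.
Let Boxphi := @Box_phi R n i0 i1 d b beta i01 d0 d12 b0 betab tau tau0 tau12 tau4 taub.
Let crossf := @cross_far R n i0 i1 d b beta i01 d0 d12 b0 betab tau tau0 tau12 tau4 taub.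

(* A node of the tree is (base point, scale, omega-mass). *)
Definition child e q : node := (phi e q.1.1, tau * q.1.2, 4^-1 * q.2).

Fixpoint nodes N : seq node := if N is N'.+1 then
  (0, 1, 1) :: [seq child e q | e <- enum {: bool * bool}, q <- nodes N'] else [::].

(** By beta = B + h / 2, the center of this cube is the sigma-point [zm] rescaled to the node. *)
Definition node_cube q : cube R n := (q.1.1 + (q.1.2 * B%:R) *: const_mx 1, q.1.2 * h).

Lemma h_gt0 : 0 < h. Proof. by rewrite hE invr_gt0 exprn_gt0. Qed.

Lemma nodes_ind (P : nat -> node -> Prop) :
  (forall N, P N.+1 (0, 1, 1)) ->
  (forall N e q, q \in nodes N -> P N q -> P N.+1 (child e q)) ->
  forall N q, q \in nodes N -> P N q.
Proof.
move=> P0 PS; elim=> // N IH q /=; rewrite inE => /orP[/eqP ->|]; first exact: P0.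
by move=> /allpairsP[[e q'] [_ q'N ->]]; apply: PS => //; exact: IH.
Qed.

(** Each of the N generations has total mass one; this is the source of the linear growth of the
    energy. *)
Lemma nodes_mass N : \sum_(q <- nodes N) q.2 = N%:R.
Proof.
elim: N => [|N IH] /=; first by rewrite big_nil.
rewrite big_cons big_allpairs_dep big_enum /= -(nat1r N); congr (1 + _).
by rewrite -[RHS]sum_quarter; apply: eq_bigr => e _; rewrite -mulr_sumr IH.
Qed.

Lemma node_scale N q : q \in nodes N -> exists2 k, (k < N)%N & q.1.2 = tau ^+ k.
Proof.
move: N q; apply: nodes_ind => [N|N e q _ [k kN qk]]; first by exists 0%N; rewrite ?expr0.
by exists k.+1; rewrite //= qk exprS.
Qed.

Lemma node_scale_gt0 N q : q \in nodes N -> 0 < q.1.2.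
Proof. by move=> /node_scale[k _ ->]; rewrite exprn_gt0. Qed.

Lemma node_mass_gt0 N q : q \in nodes N -> 0 < q.2.
Proof. by move: N q; apply: nodes_ind => // N e q _ q0; rewrite mulr_gt0 ?invr_gt0. Qed.

(** Thanks to the rounding, each child map adds a multiple of tau, and tau, a power of 2, is an
    integral multiple of every scale tau^(k+1). *)
Lemma node_lattice N q i : q \in nodes N -> exists z : int, q.1.1 ord0 i = q.1.2 * z%:~R.
Proof.
move: N q; apply: nodes_ind => [N|N e q qN [z qz]] /=; first by exists 0; rewrite mxE mulr0.
have [k _ qk] := node_scale qN.
exists (Num.floor (child_center i0 i1 d b beta e ord0 i / tau) * 2 ^+ (m * k) + z).
rewrite phiE qz mxE rmorphD rmorphM rmorphXn /= mulrDr mulrA.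
congr (_ + _); rewrite -!mulrA; congr (_ * _).
rewrite mulrCA qk tauE exprVn -exprM mulVf ?mulr1// expf_neq0//.
Qed.

Lemma node_cube_grid N q : q \in nodes N -> in_grid (@grid0 R n) (node_cube q).
Proof.
move=> qN; have [k _ qk] := node_scale qN.
have E : (node_cube q).2 = 2 ^- (m * k + a).
  by rewrite /node_cube /= qk tauE hE exprVn -exprM exprD invfM.
apply: (in_grid_lattice E) => i; have [z qz] := node_lattice i qN.
exists ((z + B%:Z) * 2 ^+ a); rewrite /node_cube /= !mxE qz mulr1 rmorphM rmorphXn rmorphD /=.
by rewrite hE; field; rewrite expf_neq0.
Qed.

Lemma node_cube_child e q x : cube_set (node_cube (child e q)) x <->
  exists2 y, cube_set (node_cube q) y & x = phi e y.
Proof.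
have ts0 := tau0.
have key y : cube_set (node_cube (child e q)) (phi e y) <-> cube_set (node_cube q) y.
  have E i : ((node_cube (child e q)).1 ord0 i <= phi e y ord0 i < (node_cube (child e q)).1 ord0 i +
      (node_cube (child e q)).2) = ((node_cube q).1 ord0 i <= y ord0 i < (node_cube q).1 ord0 i + (node_cube q).2).
    rewrite /node_cube /child /= !mxE !mulr1 -!addrA lerD2l ltrD2l -!mulrA -!mulrDr.
    by rewrite ler_pM2l// ltr_pM2l// addrA.
  by split=> H i; have := H i; rewrite E.
split=> [xI|[y yI ->]]; last exact/key.
have xE : x = phi e (tau^-1 *: (x - rounded_center e)).
  by rewrite /phi_map scalerA mulfV ?gt_eqF// scale1r addrC subrK.
by exists (tau^-1 *: (x - rounded_center e)) => //; apply/key; rewrite -xE.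
Qed.

Lemma node_cube_Box N q x : q \in nodes N -> cube_set (node_cube q) x -> Box beta x.
Proof.
move=> qN; move: N q qN x; apply: nodes_ind => [N x xI i|N e q _ IH x].
  have := xI i; rewrite /node_cube /= !mxE mulr1 !mul1r add0r.
  have ? := h_gt0; have ? := h2; have ? := betaE; have ? : 0 <= B%:R :> R by [].
  by rewrite /box_side => /andP[? ?]; apply/andP; split; lra.
by move=> /node_cube_child[y yI ->]; apply: Boxphi; exact: IH yI.
Qed.

(** [beta + d] is the coordinate of the midpoint of [zm] and [zp]. Along [i0] the centers of the
    children are at distance 1 from it, and their points are displaced by less than 1/4. *)
Lemma phi_i0_far e x : Box beta x -> 2^-1 < `|phi e x ord0 i0 - (beta + d)|.
Proof.
move=> /(phic e i0); rewrite child_center_coord eqxx (negbTE i01) mulr1 mulr0 addr0 ltr_norml.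
have ? := tau4; move=> /andP[p1 p2]; rewrite ltNge ler_norml; apply/negP => /andP[? ?].
by move: p1 p2; rewrite /sgn; case: e.1 => ? ?; lra.
Qed.

Lemma node_cube_root x : cube_set (node_cube (0, 1, 1)) x -> `|x ord0 i0 - (beta + d)| <= 2^-1.
Proof.
move=> /(_ i0); rewrite /node_cube /= !mxE mulr1 !mul1r add0r ler_norml.
have ? := h_gt0; have ? := h2; have ? := betaE; have ? := dh; have ? := d0.
by move=> /andP[? ?]; apply/andP; split; lra.
Qed.

Lemma phi_inj2 e e' x y : Box beta x -> Box beta y -> phi e x = phi e' y -> e = e' /\ x = y.
Proof.
move=> Bx By E; have ee' : e = e'.
  apply/eqP/negP => /negP /crossf /(_ Bx By); rewrite E subrr.
  rewrite /enorm big1 => [|i _]; last by rewrite mxE expr0n.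
  by rewrite sqrtr0 leNgt lt_min invr_gt0 ltr0n b0.
split=> //; move: E; rewrite ee' => /addrI /(congr1 (fun v => tau^-1 *: v)).
by rewrite !scalerA mulVf ?gt_eqF// !scale1r.
Qed.

(** Along [i0] the cube of the root stays within 1/2 of the midpoint of its sigma-points, while all
    cubes below stay farther away; two cubes below the root are handled by [phi_inj2] and
    induction. *)
Lemma node_cube_disjoint N q q' x : q \in nodes N -> q' \in nodes N ->
  cube_set (node_cube q) x -> cube_set (node_cube q') x -> q = q'.
Proof.
elim: N q q' x => // N IH q q' x /=; rewrite !inE.
have root_child e q1 y : q1 \in nodes N -> cube_set (node_cube (0, 1, 1)) y ->
    cube_set (node_cube (child e q1)) y -> False.
  move=> q1N /node_cube_root + /node_cube_child[z zI yz]; rewrite yz leNgt => /negP; apply.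
  exact: phi_i0_far (node_cube_Box q1N zI).
move=> /orP[/eqP ->|/allpairsP[[e q1] [_ /= q1N ->]]]
  /orP[/eqP ->|/allpairsP[[e' q1'] [_ /= q1N' ->]]] //.
- by move=> h1 h2'; exfalso; exact: (root_child _ _ _ q1N' h1 h2').
- by move=> h1 h2'; exfalso; exact: (root_child _ _ _ q1N h2' h1).
move=> /node_cube_child[y yI ->] /node_cube_child[y' yI' E].
have [ee' yy'] := phi_inj2 (node_cube_Box q1N yI) (node_cube_Box q1N' yI') E.
by rewrite ee' (IH _ _ y q1N q1N' yI)// yy'.
Qed.

Lemma node_cube_nonempty N q : q \in nodes N -> cube_set (node_cube q) (node_cube q).1.
Proof. by move=> /node_cube_grid/in_grid_side_gt0; exact: corner_in. Qed.

Lemma nodes_uniq N : uniq (nodes N).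
Proof.
elim: N => //= N IH; apply/andP; split.
  apply/allpairsP => -[[e q] [_ /= qN [_ E _]]].
  have [k _ qk] := node_scale qN; have ? := tau12.
  have : tau ^+ k <= 1 by rewrite exprn_ile1 ?ltW//; lra.
  by move: E; rewrite qk => E H; have := ler_wpM2l (ltW tau0) H; lra.
apply: allpairs_uniq => //; first exact: enum_uniq.
move=> [? ?] [? ?] /allpairsP[[e q] [_ /= qN [-> ->]]] /allpairsP[[e' q'] [_ /= qN' [-> ->]]].
rewrite /= => E; have yI := node_cube_nonempty qN.
have : cube_set (node_cube (child e q)) (phi e (node_cube q).1) by apply/node_cube_child; exists (node_cube q).1.
rewrite E => /node_cube_child[y' yI' E'].
have [ee' yy'] := phi_inj2 (node_cube_Box qN yI) (node_cube_Box qN' yI') E'.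
by rewrite ee' (node_cube_disjoint qN qN' yI)// yy'.
Qed.

(** The box of the node without the slab of half-width rho / 2 around the midpoint of its
    sigma-points. *)
Definition good q : set (pt R n) := [set x |
  (forall k, 0 <= x ord0 k - q.1.1 ord0 k <= q.1.2 * L) /\
  q.1.2 / 2 < `|x ord0 i0 - q.1.1 ord0 i0 - q.1.2 * (beta + d)|].

Lemma good_child e q x : good q x -> good (child e q) (phi e x).
Proof.
move=> [g1 g2].
have E k : phi e x ord0 k - phi e q.1.1 ord0 k = tau * (x ord0 k - q.1.1 ord0 k).
  by rewrite !phiE; ring.
split=> [k|]; rewrite /= E.
  have /andP[h1 h2'] := g1 k.
  by rewrite mulr_ge0 ?(ltW tau0)//= -mulrA ler_pM2l.
by rewrite -!mulrA -mulrBr normrM (gtr0_norm tau0) ltr_pM2l.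
Qed.

(** At the root all of omega lies in the good set; [child e] carries this along with the weight 1/4,
    the other three children being discarded. *)
Lemma omega_good N q : q \in nodes N ->
  q.2 <= wsum (omegaN N) (fun x => `[< good q x >]%:R).
Proof.
move: N q; apply: nodes_ind => [N|N e q qN IH] /=.
  rewrite -[leLHS](omegaN_mass tau rounded_center N.+1); apply: le_wsum; first exact: omegaN_pos.
  move=> p /allpairsP[[e x] [_ /= xN ->]] /=; rewrite asboolT//.
  have B0 : Box beta (0 : pt R n).
    by move=> k; rewrite mxE lexx /box_side; have ? := betab; have ? := b0; lra.
  have Bx : Box beta x.1 by exact: (Box_omegaN B0 Boxphi xN).
  have z0 k : (0 : pt R n) ord0 k = 0 by rewrite mxE.
  split=> [k|] /=; rewrite z0 subr0 mul1r; first exact: Boxphi.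
  by rewrite mul1r; exact: phi_i0_far.
rewrite wsum_omegaS (bigD1 e)//= -[leLHS]addr0 lerD//.
  rewrite ler_pM2l ?invr_gt0//; apply: (le_trans IH).
  apply: le_wsum; first exact: omegaN_pos.
  move=> p _ /=; have [gp|gp] := pselect (good q p.1); last by rewrite (asboolF gp).
  by rewrite (asboolT gp) (asboolT (good_child e gp)).
apply: sumr_ge0 => e' _; rewrite mulr_ge0 ?invr_ge0//.
by apply: wsum_ge0; first exact: omegaN_pos.
Qed.

(** Passing to a child multiplies rho^s by tau^s and divides the omega-mass by 4, so rho^(2s) / u
    picks up exactly the weight 4 * tau^(2s) used in [sigmaN]. *)
Lemma sigma_node N q z : q \in nodes N -> z \in [:: zm; zp] ->
  (q.1.1 + q.1.2 *: z, powR q.1.2 s ^+ 2 / q.2) \in sigmaN N.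
Proof.
move=> qN zz; move: N q qN; apply: nodes_ind => [N|N e q qN IH].
  rewrite /= scale1r add0r powR1 expr1n divr1 !inE.
  by move: zz; rewrite !inE => /orP[] /eqP ->; rewrite eqxx ?orbT.
rewrite /= !inE; apply/orP; right; apply/orP; right; apply/allpairsP.
exists (e, (q.1.1 + q.1.2 *: z, powR q.1.2 s ^+ 2 / q.2)); split=> //=.
  by rewrite mem_enum.
have q0 := node_scale_gt0 qN; have u0 := node_mass_gt0 qN.
congr (_, _).
  by rewrite /phi_map scalerDr scalerA addrA.
by rewrite powRM ?(ltW q0) ?(ltW tau0)//; field; rewrite gt_eqF.
Qed.

End Nodes.

(** * Lower bound for the energy *)

Lemma esum_seq_ge (R : realType) (T : choiceType) (P : set T) (f : T -> \bar R) (r : seq T) :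
  uniq r -> (forall x, x \in r -> P x) ->
  (\sum_(x <- r) f x <= \esum_(x in P) f x)%E.
Proof.
move=> ur rP; apply: esum_ge; exists [set` r]; last by rewrite -fsbig_seq.
by split; [exact: finite_seq|move=> x /= /rP].
Qed.

Section Projection.
Context {R : realType} {n : nat}.
Implicit Types (mu : dmeas R n) (A : set (pt R n)).

Lemma dint_ge0 mu A f : pos_dmeas mu -> (forall x, 0 <= f x) -> 0 <= dint mu A f.
Proof.
move=> mu0 f0; rewrite /dint big_seq; apply: sumr_ge0 => q /mu0 q0.
by case: ifP => // _; rewrite mulr_ge0// ltW.
Qed.

Lemma proj_x_sq_ge0 mu (M : cube R n) : pos_dmeas mu -> 0 <= proj_x_sq mu M.
Proof. by move=> mu0; apply: dint_ge0 => // x; exact: sqr_ge0. Qed.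

(** Two atoms suffice, since (X - a)^2 + (Y - a)^2 >= (X - Y)^2 / 2 for every average [a]; their
    distinct coordinates make them different entries of the list. *)
Lemma proj_x_sq_ge mu (M : cube R n) x y (w : R) i : pos_dmeas mu ->
  (x, w) \in mu -> (y, w) \in mu -> x ord0 i != y ord0 i ->
  cube_set M x -> cube_set M y ->
  w * (x ord0 i - y ord0 i) ^+ 2 / 2 <= proj_x_sq mu M.
Proof.
move=> mu0 xmu ymu xy Mx My; rewrite /proj_x_sq; set avg := _ *: _.
have w0 := mu0 _ xmu; rewrite /= in w0.
have xyn : (y, w) != (x, w) by apply: contra xy => /eqP [->].
rewrite /dint (big_rem _ xmu) /= asboolT//.
have ymu' : (y, w) \in rem (x, w) mu.
  by move: ymu; rewrite (perm_mem (perm_to_rem xmu)) inE (negbTE xyn).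
rewrite (big_rem _ ymu') /= asboolT//.
set S := \sum_(_ <- _) _; have S0 : 0 <= S.
  rewrite /S big_seq; apply: sumr_ge0 => q /mem_rem /mem_rem /mu0 q0.
  by case: ifP => // _; rewrite mulr_ge0 ?sqr_ge0// ltW.
have le_sq (v : pt R n) : v ord0 i ^+ 2 <= enorm v ^+ 2.
  by apply: sqr_norm_le; exact: coord_le_enorm.
have := ler_wpM2r (ltW w0) (le_sq (x - avg)); have := ler_wpM2r (ltW w0) (le_sq (y - avg)).
rewrite !subvE; set X := x ord0 i; set Y := y ord0 i; set a := avg ord0 i.
have : 0 <= w * ((X - a) + (Y - a)) ^+ 2 by rewrite mulr_ge0 ?sqr_ge0// ltW.
by move: (enorm (x - avg) ^+ 2 * w) (enorm (y - avg) ^+ 2 * w) => e1 e2; lra.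
Qed.

End Projection.

Section Energy.
Context {R : realType} {n : nat}.
Variables (i0 i1 : 'I_n) (alpha d b beta tau h gam eps : R) (m a B r qq KK : nat).
Let s : R := n%:R - alpha.
Hypotheses (i01 : i0 != i1) (s0 : 0 < s) (d0 : 0 < d) (d12 : d <= 2^-1) (b0 : 0 < b).
Hypothesis betab : b + 1 <= beta.
Hypotheses (tau0 : 0 < tau) (tau12 : tau <= 2^-1).
Hypotheses (tau4 : tau * (1 + box_side beta) <= 4^-1) (taub : 2 * (tau * (1 + box_side beta)) <= b).
Hypotheses (tauE : tau = 2 ^- m) (hE : h = 2 ^- a) (betaE : beta = B%:R + h / 2).
Hypotheses (gam1 : 1 < gam) (hgam : h * (2 + gam) <= 2^-1) (dE : 4 * d = 2 ^- qq.+1 * h).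
Hypotheses (rq : (r <= qq.+1)%N)
  (deepq : 2^-1 * powR (2 ^- qq.+1) eps <= 2^-1 - 2 ^- qq.+1).
Hypothesis KKL : box_side beta < 2 ^+ KK.

Local Notation L := (box_side beta).
Local Notation zm := (@zm R n beta).
Local Notation zp := (@zp R n i0 d beta).
Local Notation rounded_center := (rounded_center i0 i1 d b beta tau).
Local Notation phi := (phi_map tau rounded_center).
Local Notation omegaN := (omegaN tau rounded_center).
Local Notation sigmaN := (sigmaN tau (powR tau s) rounded_center zm zp).
Local Notation nodes := (nodes i0 i1 d b beta tau).
Local Notation Icube := (node_cube h B).
Local Notation grid0 := (@grid0 R n).

Let h0 : 0 < h. Proof. by rewrite hE invr_gt0 exprn_gt0. Qed.
Let h2 : h <= 2^-1.
Proof.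
have := mulr_gt0 h0 (lt_trans ltr01 gam1); have := h0; have := hgam.
by rewrite mulrDr; lra.
Qed.
Let q1 : (2 ^- qq.+1 : R) <= 1.
Proof. by rewrite invf_le1 ?exprn_gt0// exprn_ege1// ler1n. Qed.
Let dh : 4 * d <= h. Proof. by rewrite dE ler_piMl// ltW. Qed.
Let n0 : (0 < n)%N. Proof. by case: (n) i0 => // -[]. Qed.
Let L0 : 0 < L.
Proof. by have := b0; have := betab; rewrite /box_side; lra. Qed.

(** The cube [I] of the energy constant; it contains all of omega, hence has mass one. *)
Definition topcube : cube R n := (0, 2 ^+ KK).

Lemma Box_topcube x : Box beta x -> cube_set topcube x.
Proof.
move=> Bx i; have /andP[x0 xL] := Bx i.
by rewrite /= mxE x0 add0r (le_lt_trans xL KKL).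
Qed.

Let B0 : Box beta (0 : pt R n).
Proof. by move=> k; rewrite mxE lexx ltW. Qed.
Let Boxphi := @Box_phi R n i0 i1 d b beta i01 d0 d12 b0 betab tau tau0 tau12 tau4 taub.

Lemma omega_topcube N p : p \in omegaN N -> cube_set topcube p.1.
Proof. by move=> pN; apply: Box_topcube; exact: (Box_omegaN B0 Boxphi pN). Qed.

Lemma dmass_topcube N : dmass (omegaN N) (cube_set topcube) = 1.
Proof.
rewrite -(omegaN_mass tau rounded_center N) /dmass /wsum; apply: eq_big_seq => p pN.
by rewrite (asboolT (omega_topcube pN)) mulr1.
Qed.

(** The lower corner is the rescaled [zm] and the side is 4 * d * rho, so this grid cube contains
    both sigma-points of the node. *)
Definition Jcube (q : pt R n * R * R) : cube R n :=
  ((Icube q).1 + ((Icube q).2 / 2) *: const_mx 1, 2 ^- qq.+1 * (Icube q).2).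

Lemma Jcube_grid N q : q \in nodes N -> in_grid grid0 (Jcube q).
Proof.
move=> qN; have [k _ qk] := node_scale qN.
have E : (Jcube q).2 = 2 ^- (qq.+1 + (m * k + a)).
  by rewrite /Jcube /node_cube /= qk tauE hE exprVn -exprM !exprD !invfM.
apply: (in_grid_lattice E) => i; have [z qz] := node_lattice tauE i qN.
(* The last summand is half the side of the node cube, in units of the side of [Jcube]. *)
exists ((z + B%:Z) * 2 ^+ a * 2 ^+ qq.+1 + 2 ^+ qq).
rewrite /Jcube /node_cube /= !mxE qz !mulr1 !rmorphD !rmorphM !rmorphXn !rmorphD /= hE !exprS.
by field; rewrite !expf_neq0.
Qed.

Lemma Jcube_z q z : 0 < q.1.2 -> z \in [:: zm; zp] -> cube_set (Jcube q) (q.1.1 + q.1.2 *: z).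
Proof.
move=> q0 zz i; have ? := d0.
have E1 : q.1.2 * beta = q.1.2 * B%:R + q.1.2 * h / 2 by rewrite betaE; ring.
have E2 : 2 ^- qq.+1 * (q.1.2 * h) = q.1.2 * (4 * d) by rewrite dE; ring.
have E3 := mulr_gt0 q0 d0.
rewrite /Jcube /node_cube /= E2.
move: zz; rewrite !inE => /orP[] /eqP ->; rewrite !mxE ?eqxx ?mulr1; first by apply/andP; split; lra.
by case: (i == i0); rewrite /= ?mulr1 ?mulr0; apply/andP; split; lra.
Qed.

Lemma half_subset (Q : cube R n) : 0 < Q.2 -> cube_set (Q.1, Q.2 / 2) `<=` cube_set Q.
Proof.
case: Q => c l /= l0 x xh i; have /= /andP[? ?] := xh i.
by apply/andP; split=> /=; lra.
Qed.

Lemma in_grid_half (Q : cube R n) : in_grid grid0 Q -> in_grid grid0 (Q.1, Q.2 / 2).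
Proof.
move=> /in_grid0[k [z [Qk Qz]]]; apply/in_grid0; exists (k - 1), (fun i => 2 * z i).
have E : (2 : R) ^ (k - 1) = 2 ^ k / 2 by rewrite expfzDr ?pnatr_eq0.
rewrite E Qk; split=> // i.
by rewrite /= Qz rmorphM /= mulrA divfK ?pnatr_eq0.
Qed.

(** This is (u / V)^2 * (rho^(2s) / u) * (2 * d * rho)^2 / 2 divided by u, for V = (rho * (1 + n *
    L))^(s+1): all powers of rho cancel. *)
Definition energy_const : R := 2 * d ^+ 2 / powR (1 + n%:R * L) (s + 1) ^+ 2.

(** A maximal deeply embedded cube [M] around [Jcube] contains both sigma-points, which bounds the
    projection from below. The Poisson integral sees at least the mass u of the good set, which
    avoids [dilate gam M] and lies within a multiple of rho from [M]. *)
Lemma node_energy N q : q \in nodes N -> exists2 M,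
  Mdeep_l grid0 r eps 1 (Icube q) M &
  energy_const * q.2 <=
    (poisson alpha M (omegaN N) (cube_set topcube `\` cube_set (dilate gam M)) / side M) ^+ 2
    * proj_x_sq (sigmaN N) M.
Proof.
move=> qN; have q0 := node_scale_gt0 tau0 qN; have u0 := node_mass_gt0 qN.
have Ig : in_grid grid0 (Icube q) := node_cube_grid B tauE hE qN.
have I0 := in_grid_side_gt0 Ig.
have Jd : deep_emb r eps (Jcube q) (Icube q) by exact: deep_emb_center.
have [M MM JM] := exists_Mdeep n0 (Jcube_grid qN) Jd.
have [Mg [[MI _] _]] := MM; have M0 := in_grid_side_gt0 Mg.
exists M.
  split; last by exists M; split.
  (* For l = 1 the ancestor of a dyadic child may be the node cube itself, so [Mdeep] of that cube
     is part of [Mdeep_l]. *)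
  exists ((Icube q).1, (Icube q).2 / 2), (Icube q).
  have half : cube_set ((Icube q).1, (Icube q).2 / 2) `<=` cube_set (Icube q).
    exact: half_subset.
  split; first by split; [exact: in_grid_half|split].
  by split=> //; split=> //; split=> //; rewrite /side /= expr1; field.
set p := q.1.1 in q0 *; set rho := q.1.2 in q0 *; set u := q.2 in u0 *.
have Mside : M.2 <= rho * h := subset_side n0 M0 MI.
have c_range i : p ord0 i + rho * B%:R <= Defs.center M ord0 i < p ord0 i + rho * B%:R + rho * h.
  by have := MI _ (center_in M0) i; rewrite /node_cube /= !mxE mulr1.
pose D := 1 + n%:R * L; have D0 : 0 < D by rewrite ltr_wpDr// mulr_ge0// ltW.
pose V := powR (rho * D) (s + 1).
have V0 : 0 < V by rewrite powR_gt0// mulr_gt0.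
have rh0 := mulr_gt0 q0 h0.
have rhoh : rho * h <= rho by rewrite ler_piMr ?(ltW q0)//; have := h2; lra.
have BL : rho * B%:R + rho * h <= rho * L.
  rewrite -mulrDr ler_pM2l// /box_side; have := betaE; have := h0; have := h2; have := ler0n R B; lra.
have rB0 : 0 <= rho * B%:R by rewrite mulr_ge0// ltW.
(* Along [i0], a point of the dilated cube is within rho * h * (2 + gam) <= rho / 2 of the midpoint
   of the sigma-points, hence in the removed slab. *)
have far x : good i0 d beta q x -> ~ cube_set (dilate gam M) x.
  move=> [_ +] /(_ i0); rewrite /dilate /= -/p -/rho !mxE mulr1.
  have /andP[c1 c2] := c_range i0; rewrite /Defs.center !mxE mulr1 in c1 c2 *.
  have g1 : gam * M.2 <= gam * (rho * h) by rewrite ler_pM2l// (lt_trans ltr01 gam1).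
  have g2 : rho * (h * (2 + gam)) <= rho * 2^-1 by rewrite ler_pM2l.
  have g3 : rho * (4 * d) <= rho * h by rewrite ler_pM2l.
  have g4 : 0 < rho * d by rewrite mulr_gt0.
  have g5 : rho * beta = rho * B%:R + rho * h / 2 by rewrite betaE; ring.
  rewrite ltNge ler_norml mulrDr g5 => /negP H /andP[x1 x2]; apply: H; apply/andP; split; lra.
have close_to x : good i0 d beta q x -> M.2 + enorm (x - Defs.center M) <= rho * D.
  move=> [xr _]; rewrite /D mulrDr mulr1 lerD ?(le_trans Mside)// mulrCA.
  apply: enorm_le => k; rewrite subvE.
  have /andP[x1 x2] := xr k; have /andP[c1 c2] := c_range k.
  by rewrite -/p -/rho in x1 x2; rewrite ler_norml; apply/andP; split; lra.
have s10 : 0 <= s + 1 by rewrite (le_trans (ltW s0))// lerDl.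
have sE : n%:R + 1 - alpha = s + 1 by rewrite /s; ring.
have Pge : u * (M.2 / V) <= poisson alpha M (omegaN N) (cube_set topcube `\` cube_set (dilate gam M)).
  apply: le_trans (_ : wsum (omegaN N) (fun x => M.2 / V * `[< good i0 d beta q x >]%:R) <= _).
    rewrite wsumZ mulrC ler_pM2l ?divr_gt0//.
    exact: (@omega_good R n i0 i1 d b beta tau).
  rewrite /wsum /poisson /dint !big_seq; apply: ler_sum => x xN.
  have x0 := omegaN_pos xN; rewrite sE.
  have [gx|gx] := pselect (good i0 d beta q x.1); last first.
    rewrite (asboolF gx) !mulr0; case: ifP => // _.
    by rewrite mulr_ge0 ?(ltW x0)// divr_ge0 ?powR_ge0 ?(ltW M0).
  rewrite (asboolT gx) mulr1 asboolT; last by split; [exact: omega_topcube xN|exact: far].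
  rewrite mulrC ler_wpM2r ?(ltW x0)// /side ler_pM2l// lef_pV2 ?posrE//.
    apply: (ge0_ler_powR s10); rewrite ?nnegrE; last exact: close_to.
      by rewrite addr_ge0 ?enorm_ge0 ?(ltW M0).
    by rewrite mulr_ge0 ?(ltW q0) ?(ltW D0).
  by rewrite powR_gt0// ltr_pwDl// enorm_ge0.
have ts0 : 0 < powR tau s by rewrite powR_gt0.
have zz1 : zm \in [:: zm; zp] by rewrite inE eqxx.
have zz2 : zp \in [:: zm; zp] by rewrite !inE eqxx orbT.
have memz z := @sigma_node R n i0 i1 s d b beta tau tau0 N q z qN.
have diff : (p + rho *: zm) ord0 i0 - (p + rho *: zp) ord0 i0 = - (2 * d * rho).
  by rewrite !mxE !eqxx /= mulr1; ring.
have proj := @proj_x_sq_ge R n (sigmaN N) M (p + rho *: zm) (p + rho *: zp)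
  (powR rho s ^+ 2 / u) i0 (sigmaN_pos ts0) (memz _ zz1) (memz _ zz2).
have ne : (p + rho *: zm) ord0 i0 != (p + rho *: zp) ord0 i0.
  by rewrite -subr_eq0 diff oppr_eq0 gt_eqF// !mulr_gt0.
have {}proj := proj ne (JM _ (Jcube_z q0 zz1)) (JM _ (Jcube_z q0 zz2)).
rewrite diff in proj.
(* Here the unknown side of [M] cancels. *)
have X1 : u / V <= poisson alpha M (omegaN N) (cube_set topcube `\` cube_set (dilate gam M)) / side M.
  by rewrite ler_pdivlMr// -mulrA (mulrC V^-1).
apply: le_trans (_ : (u / V) ^+ 2 * (powR rho s ^+ 2 / u * (- (2 * d * rho)) ^+ 2 / 2) <= _); last first.
  apply: ler_pM => //; first exact: sqr_ge0.
    by rewrite mulr_ge0 ?invr_ge0// mulr_ge0 ?sqr_ge0// divr_ge0 ?sqr_ge0// ltW.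
  have uV0 : 0 <= u / V by rewrite divr_ge0 ?(ltW u0) ?(ltW V0).
  by rewrite lerXn2r ?nnegrE// (le_trans uV0 X1).
rewrite /energy_const -/D -/u le_eqVlt; apply/orP; left; apply/eqP.
rewrite /V powRM ?(ltW q0) ?(ltW D0)// (powR_s1 s0 (ltW q0)).
field; rewrite !gt_eqF ?powR_gt0//.
Qed.


Lemma topcube_grid : in_grid grid0 topcube.
Proof.
apply/in_grid0; exists KK, (fun=> 0); split=> //= i; by rewrite mxE mulr0.
Qed.

Lemma grid_cube_inj (P Q : cube R n) x : in_grid grid0 P -> in_grid grid0 Q -> P.2 = Q.2 ->
  cube_set P x -> cube_set Q x -> P = Q.
Proof.
move=> Pg Qg PQ Px Qx.
have le1 : P.2 <= Q.2 by rewrite PQ.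
have le2 : Q.2 <= P.2 by rewrite PQ.
have s1 := grid_nested Pg Qg le1 Px Qx; have s2 := grid_nested Qg Pg le2 Qx Px.
rewrite (surjective_pairing P) (surjective_pairing Q) PQ; congr (_, _).
apply/rowP => i; apply/eqP; rewrite eq_le.
have /andP[-> _] := s1 _ (corner_in (in_grid_side_gt0 Pg)) i.
by have /andP[-> _] := s2 _ (corner_in (in_grid_side_gt0 Qg)) i.
Qed.

(** The node cubes are completed to a partition of the top cube by equal cubes of side 2^-(m * N +
    a). These are no larger than any node cube, so the grid puts each of them inside a node cube or
    off all of them. *)
Definition partition_cubes N : set (cube R n) := [set Q |
  (exists2 q, q \in nodes N & Q = Icube q) \/
  [/\ in_grid grid0 Q, Q.2 = (2 : R) ^ (- (m * N + a)%N%:Z),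
     cube_set Q `<=` cube_set topcube &
     forall q, q \in nodes N -> cube_set Q `&` cube_set (Icube q) = set0]].

Lemma node_cube_topcube N q : q \in nodes N -> cube_set (Icube q) `<=` cube_set topcube.
Proof.
move=> qN x xI; apply: Box_topcube.
exact: (@node_cube_Box R n i0 i1 d b beta tau h a B i01 d0 d12 b0 betab tau0 tau12 tau4 taub
  hE betaE h2 N q x qN xI).
Qed.

Lemma node_cube_inj N q q' x : q \in nodes N -> q' \in nodes N ->
  cube_set (Icube q) x -> cube_set (Icube q') x -> q = q'.
Proof.
exact: (@node_cube_disjoint R n i0 i1 d b beta tau h a B i01 d0 d12 b0 betab tau0 tau12 tau4 taub
  hE betaE h2 dh N).
Qed.

Lemma partition_cover N : cube_set topcube = \bigcup_(Q in partition_cubes N) cube_set Q.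
Proof.
apply/seteqP; split=> [x xI|x [Q [[q qN ->]|[_ _ QI _]] Qx]]; last 2 first.
- exact: (node_cube_topcube qN Qx).
- exact: QI.
have [[q qN xq]|nq] := pselect (exists2 q, q \in nodes N & cube_set (Icube q) x).
  by exists (Icube q) => //; left; exists q.
have [Q [Qg Qk Qx]] := exists_grid_cube (- (m * N + a)%N%:Z) x.
exists Q => //; right; split=> //.
  apply: (grid_nested Qg topcube_grid _ Qx xI); rewrite Qk /= exprnP exprz2_le.
  by rewrite (@le_trans _ _ 0)// oppr_le0.
move=> q qN; apply/eqP/negPn/negP => /set0P[y [Qy qy]]; apply: nq; exists q => //.
apply: (grid_nested Qg (node_cube_grid B tauE hE qN) _ Qy qy) => //.
have [k kN qk] := node_scale qN.
rewrite Qk /node_cube /= qk tauE hE exprVn -exprM -invfM -exprD exprnN exprz2_le.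
by rewrite lerN2 lez_nat leq_add2r leq_mul2l ltnW ?orbT.
Qed.

Lemma partition_disjoint N Q Q' : partition_cubes N Q -> partition_cubes N Q' -> Q <> Q' ->
  cube_set Q `&` cube_set Q' = set0.
Proof.
move=> PQ PQ' QQ'; apply/eqP/negPn/negP => /set0P[x [Qx Qx']]; apply: QQ'.
case: PQ PQ' => [[q qN QE]|[Qg Qk _ Qd]] [[q' qN' QE']|[Qg' Qk' _ Qd']].
- by rewrite QE QE'; rewrite QE QE' in Qx Qx'; rewrite (node_cube_inj qN qN' Qx Qx').
- by exfalso; rewrite QE in Qx; have := Qd' _ qN; apply/eqP/set0P; exists x.
- by exfalso; rewrite QE' in Qx'; have := Qd _ qN'; apply/eqP/set0P; exists x.
- by apply: (grid_cube_inj Qg Qg' _ Qx Qx'); rewrite Qk Qk'.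
Qed.

(** All terms are nonnegative: the filling cubes are dropped and one [M] is kept for each node. What
    remains is at least the constant times the total mass of the nodes, which is N. *)
Lemma energy_ge N : ((energy_const * N%:R)%:E <=
  bw_deep_energy_sq alpha r eps gam (sigmaN N) (omegaN N))%E.
Proof.
set term := fun M => (poisson alpha M (omegaN N) (cube_set topcube `\` cube_set (dilate gam M))
   / side M) ^+ 2 * proj_x_sq (sigmaN N) M.
have term0 M : 0 <= term M.
  by rewrite mulr_ge0 ?sqr_ge0// proj_x_sq_ge0//; apply: sigmaN_pos; rewrite powR_gt0.
pose E := (\esum_(Ir in partition_cubes N) \esum_(M in Mdeep_l grid0 r eps 1 Ir) (term M)%:E)%E.
apply: (@le_trans _ _ E); last first.
  apply: ereal_sup_ubound; exists 1%N, grid0, topcube, (partition_cubes N).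
  split=> //; split; first exact: grid0_ok.
  split; first exact: topcube_grid.
  split.
    move=> Q [[q qN ->]|[]//]; split; first exact: (node_cube_grid B tauE hE qN).
    exact: node_cube_topcube qN.
  split; first exact: partition_disjoint.
  split; first exact: partition_cover.
  by rewrite dmass_topcube invr1 mul1e.
have Iuniq : uniq [seq Icube q | q <- nodes N].
  rewrite map_inj_in_uniq.
    exact: (@nodes_uniq R n i0 i1 d b beta tau h m a B i01 d0 d12 b0 betab tau0 tau12 tau4 taub
      tauE hE betaE h2 dh N).
  move=> q q' qN qN' E1; have qI := node_cube_grid B tauE hE qN.
  have c1 := corner_in (in_grid_side_gt0 qI).
  by apply: (node_cube_inj qN qN' c1); rewrite -E1.
apply: le_trans (esum_seq_ge _ Iuniq _); last first.
  by move=> Q /mapP[q qN ->]; left; exists q.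
rewrite big_map -(nodes_mass i0 i1 d b beta tau N) mulr_sumr -sumEFin.
rewrite big_seq [leRHS]big_seq; apply: lee_sum => q qN.
have [M MM HM] := node_energy qN.
apply: esum_ge; exists [set M]; first by split=> [|_ ->//]; exact: finite_set1.
by rewrite fsbig_set1 lee_fin.
Qed.

End Energy.

(** * Choice of the parameters and conclusion *)

Lemma exists_deep_scale (R : realType) (eps : R) (r : nat) : 0 < eps ->
  exists2 q : nat, (r <= q.+1)%N &
    2^-1 * powR (2 ^- q.+1) eps <= 2^-1 - 2 ^- q.+1 :> R.
Proof.
(* For 2^-(q+1) <= y the right side is at least 1/4 by the first bound, and the left side at most
   1/4 by the second. *)
move=> eps0; pose y : R := Num.min 4^-1 (powR 2^-1 eps^-1).
have y0 : 0 < y by rewrite lt_min powR_gt0 ?invr_gt0// ltr0n.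
have [m my] := exists_pow2_le y0; exists (maxn r m); first by rewrite leqW// leq_maxl.
have qy : 2 ^- (maxn r m).+1 <= y.
  apply: le_trans my; rewrite lef_pV2 ?posrE ?exprn_gt0// ler_eXn2l ?ltr1n//.
  by rewrite leqW// leq_maxr.
set z := 2 ^- _ in qy *; have z0 : 0 < z by rewrite invr_gt0 exprn_gt0.
have z4 : z <= 4^-1 by rewrite (le_trans qy)// ge_min lexx.
have zp : z <= powR 2^-1 eps^-1 by rewrite (le_trans qy)// ge_min lexx orbT.
have : powR z eps <= 2^-1.
  have <- : powR (powR 2^-1 eps^-1) eps = 2^-1 :> R.
    by rewrite -powRrM mulVf ?gt_eqF// powRr1// invr_ge0.
  by rewrite ge0_ler_powR ?nnegrE ?powR_ge0 ?(ltW eps0) ?(ltW z0).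
by lra.
Qed.

(** The parameters q, h, d, b and beta are fixed first, in this order, and determine [c] and [C];
    only tau is chosen after N. *)
Lemma uniform_example (R : realType) (n : nat) (alpha : R) (r : nat) (eps gam : R) :
  (2 <= n)%N -> alpha < n%:R -> 0 < eps -> 1 < gam ->
  exists c C : R, 0 < c /\ forall N, (0 < N)%N -> exists so : dmeas R n * dmeas R n,
    [/\ pos_dmeas so.1, pos_dmeas so.2,
      ((c * N%:R)%:E <= bw_deep_energy_sq alpha r eps gam so.1 so.2)%E &
      forall (f : pt R n -> R) (delta R0 : R),
        L2norm_vec so.2 (riesz_trunc alpha so.1 delta R0 f) <= C * L2norm so.1 f].
Proof.
move=> n2 alphan eps0 gam1.
pose i0 := Ordinal (ltnW n2); pose i1 := Ordinal n2.
have i01 : i0 != i1 by [].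
pose s : R := n%:R - alpha; have s0 : 0 < s by rewrite subr_gt0.
have [q rq deepq] := exists_deep_scale r eps0.
have [|a ha] := @exists_pow2_le R (2 * (2 + gam))^-1.
  by rewrite invr_gt0; lra.
pose h : R := 2 ^- a; have h0 : 0 < h by rewrite invr_gt0 exprn_gt0.
have hgam : h * (2 + gam) <= 2^-1.
  have g2 : 0 < 2 + gam by lra.
  by rewrite -ler_pdivlMr// -invfM.
have h2 : h <= 2^-1.
  by have := mulr_gt0 h0 (lt_trans ltr01 gam1); move: hgam; rewrite mulrDr; lra.
pose d : R := 2 ^- q.+1 * h / 4.
have q0 : 0 < 2 ^- q.+1 :> R by rewrite invr_gt0 exprn_gt0.
have q1 : 2 ^- q.+1 <= 1 :> R by rewrite invf_le1 ?exprn_gt0// exprn_ege1// ler1n.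
have d0 : 0 < d by rewrite !divr_gt0 ?mulr_gt0.
have dE : 4 * d = 2 ^- q.+1 * h by rewrite /d mulrC divfK.
have d12 : d <= 2^-1 by have := ler_wpM2r (ltW h0) q1; lra.
have d1 : d < 1 by lra.
have s1 : 1 < s + 1 by rewrite ltrDr.
have [b b0 bal] := exists_balanced d0 d1 s1.
have b10 : 0 <= b + 1 by lra.
(* An integer plus h / 2: the node cubes get dyadic corners and are centered at the copies of
   [zm]. *)
pose B := Num.bound (b + 1); pose beta : R := B%:R + h / 2.
have betab : b + 1 <= beta.
  by have := archi_boundP b10; rewrite -/B /beta; lra.
have L0 : 0 <= box_side beta by rewrite /box_side; lra.
pose KK := Num.bound (box_side beta).
have KKL : box_side beta < 2 ^+ KK.
  apply: lt_le_trans (archi_boundP L0) _.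
  by rewrite -natrX ler_nat; exact/ltnW/ltn_expl.
have nL0 : 0 < 1 + n%:R * box_side beta by rewrite ltr_wpDr// mulr_ge0.
exists (@energy_const R n alpha d beta).
exists (Num.sqrt (n%:R * (2 * (8 * ((powR (Num.min 4^-1 b) s)^-1) ^+ 2 + 1)))).
split; first by rewrite divr_gt0 ?exprn_gt0 ?powR_gt0// mulr_gt0 ?exprn_gt0.
move=> N N0.
have [tau0 tau00 Htau] := @riesz_bound_tau R n i0 i1 alpha d b beta i01 s0 d0 d12 b0 bal betab N N0.
(* A power of two below the threshold, so that all scales of the tree are dyadic. *)
have [m mtau] := exists_pow2_le tau00.
pose tau : R := 2 ^- m; have t0 : 0 < tau by rewrite invr_gt0 exprn_gt0.
have [t1 t2 t3 bound] := Htau _ t0 mtau.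
exists (sigmaN tau (powR tau s) (rounded_center i0 i1 d b beta tau) (@zm R n beta) (zp i0 d beta) N,
        omegaN tau (rounded_center i0 i1 d b beta tau) N); split=> //=.
- by apply: sigmaN_pos; rewrite powR_gt0.
- exact: omegaN_pos.
exact: (@energy_ge R n i0 i1 alpha d b beta tau h gam eps m a B r q KK).
Qed.

Unset Implicit Arguments.

Theorem theorem1 (R : realType) (n : nat) (alpha : R) (r : nat) (eps gam : R) :
  (2 <= n)%N -> 0 <= alpha -> alpha < n%:R ->
  0 < eps -> eps < 1 -> 1 < gam ->
  exists (sigma omega : nat -> dmeas R n),
    (forall N, (1 <= N)%N -> pos_dmeas (sigma N) /\ pos_dmeas (omega N)) /\
    (forall B : R, exists N, (1 <= N)%N /\
        (B%:E < bw_deep_energy_sq alpha r eps gam (sigma N) (omega N))%E) /\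
    (exists C : R, forall N, (1 <= N)%N ->
       forall (f : pt R n -> R) (delta R0 : R), 0 < delta -> delta < R0 ->
         L2norm_vec (omega N) (riesz_trunc alpha (sigma N) delta R0 f)
           <= C * L2norm (sigma N) f).
Proof.
move=> n2 _ alphan eps0 _ gam1.
have [c [C [c0 H]]] := uniform_example r n2 alphan eps0 gam1.
have /choice[so soP] : forall N, exists p : dmeas R n * dmeas R n, (0 < N)%N ->
    [/\ pos_dmeas p.1, pos_dmeas p.2,
      ((c * N%:R)%:E <= bw_deep_energy_sq alpha r eps gam p.1 p.2)%E &
      forall (f : pt R n -> R) (delta R0 : R),
        L2norm_vec p.2 (riesz_trunc alpha p.1 delta R0 f) <= C * L2norm p.1 f].
  (* At N = 0 any pair will do; the empty one is taken. *)
  by case=> [|N]; [exists ([::], [::])|have [p pP] := H N.+1 isT; exists p].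
exists (fun N => (so N).1), (fun N => (so N).2); split; [|split].
- by move=> N /soP[].
- move=> B; pose N := (Num.bound (`|B| / c)).+1; exists N; split=> //.
  have [_ _ + _] := soP N isT; apply: lt_le_trans; rewrite lte_fin.
  apply: (le_lt_trans (ler_norm B)); rewrite mulrC -ltr_pdivrMr//.
  apply: (lt_trans (archi_boundP _)); first by rewrite divr_ge0 ?(ltW c0).
  by rewrite ltr_nat.
- by exists C => N /soP[_ _ _ bound] f delta R0 _ _; exact: bound.
Qed.
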